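(* Consider a binary cellular automaton on $\mathbb Z$ and let the initial state be $\xi_0=\eta$, where $\eta\in\{0,1\}^{\mathbb Z}$ is a doubly periodic configuration with spatial period $\sigma$, shift period $\pi_0$ and shift $\sigma_0$. Fix also an initial defect configuration $\Delta_0$ (nonzero, with finite support), and let $$B_0=\{b\in\{1,\dots,d_T\}:\ \text{the edge } e_b \text{ of } \mathcal E \text{ originates from } x\bmod\sigma \text{ for some } x \text{ in the support of } \Delta_0\}.$$ Then the Lyapunov profile $L$ is proper and given by the following triple supremum: $$L(\alpha)=\sup_{b\in B_0}\ \ \sup_{\mu\in\mathcal P_{\alpha}\cap\mathcal P'_b}\ \ \sup_{q\in\mathcal K_\mu}H(q,\mu),$$ where $\mathcal E$, $d_T$, $\mathcal P_\alpha$, $\mathcal P'_b$, $\mathcal K_\mu$ and $H$ are as defined in the context (the supremum of the empty set being $-\infty$).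
   Context: A binary cellular automaton (CA) on $\mathbb Z$ is given by a finite ordered neighborhood $\mathcal N\subset\mathbb Z$ and $\phi:\{0,1\}^{|\mathcal N|}\to\{0,1\}$; its global map is $\Phi(\xi)(x)=\phi(\xi|_{x+\mathcal N})$, and the trajectory is $\xi_{t+1}=\Phi(\xi_t)$. Defect accumulation dynamics: for a configuration $\zeta$ let $\zeta^{(y)}$ be $\zeta$ with the state at $y$ flipped. Put $\mathrm{change}_t(y,x)=1$ if $\Phi(\xi_t^{(y)})(x)\neq\xi_{t+1}(x)$ and $0$ otherwise. Given $\Delta_0:\mathbb Z\to\mathbb Z_{\ge0}$, nonzero with finite support, define $\Delta_{t+1}(x)=\sum_{y\in x+\mathcal N}\mathrm{change}_t(y,x)\Delta_t(y)$; write $\Delta(x,t)=\Delta_t(x)$. Lyapunov profile: $L(\alpha)=\lim_{\epsilon\downarrow0}\limsup_{t\to\infty}\frac1t\log\bigl(\sum_{x:|x/t-\alpha|<\epsilon}\Delta(x,t)\bigr)\in\{-\infty\}\cup[0,\infty)$, with $\log 0=-\infty$. $L$ is proper if replacing $\limsup$ by $\liminf$ gives the same value for every $\alpha$. Doubly periodic configuration: there are $\pi\ge1$ with $\Phi^\pi(\eta)=\eta$ and $\sigma\ge1$ with $\eta(x)=\eta(x\bmod\sigma)$ for all $x$; $\pi$ and $\sigma$ are taken smallest possible. The shift period $\pi_0\ge1$ is the smallest time for which there is $\sigma_0\in\{0,\dots,\sigma-1\}$ with $(\Phi^{\pi_0}\eta)(x)=\eta(x-\sigma_0)$ for all $x$;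 this $\sigma_0$ is the shift. Expansion graph $\mathcal E$: a directed multigraph with vertex set $\mathbb Z_\sigma=\{0,\dots,\sigma-1\}$. For each $i$, start with $\xi_0=\eta$ and $\Delta_0=\mathbf 1_{\{i\}}$; if $\Delta_{\pi_0}$ has $n_i\ge0$ nonzero values $N^{(i)}_j$, at the sites $i+D^{(i)}_j$, $j=1,\dots,n_i$, then for each $j$ there is an edge from $i$ to $(i+D_j^{(i)}-\sigma_0)\bmod\sigma$ with displacement label $D(e)=D^{(i)}_j$ and size label $N(e)=N^{(i)}_j$. Let $e_1,\dots,e_{d_T}$ be an ordering of all edges, $d_T=\sum_i n_i$. Let $T$ be the $d_T\times d_T$ matrix with $T_{k\ell}=N(e_k)$ if the terminal vertex of $e_k$ equals the initial vertex of $e_\ell$, and $T_{k\ell}=0$ otherwise. $\mathcal P$ is the set of probability measures $\mu=(\mu_1,\dots,\mu_{d_T})$ on $\{1,\dots,d_T\}$, and, for $\alpha\in\mathbb R$, $\mathcal P_\alpha=\{\mu\in\mathcal P:\sum_k\mu_kD(e_k)=\alpha\}$. Write $k\leadsto\ell$ if $k=\ell$ or $(T^n)_{k\ell}>0$ for some $n$. For $b\in\{1,\dots,d_T\}$, $\mathcal P'_b$ is the set of $\mu\in\mathcal P$ such that for all $k,\ell\in\{1,\dots,d_T\}$: if $b\not\leadsto k$ then $\mu_k=0$; and if $\ell\not\leadsto k$ and $k\not\leadsto\ell$ then $\mu_k\mu_\ell=0$. For $\mu\in\mathcal P$, $\mathcal K_\mu$ is the set of $d_T\times d_T$ stochastic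 matrices $q=(q_{k\ell})$ (nonnegative entries, $\sum_\ell q_{k\ell}=1$ for all $k$) that leave $\mu$ invariant, i.e. $\sum_k\mu_kq_{k\ell}=\mu_\ell$ for all $\ell$. Finally $$H(q,\mu)=\sum_{k,\ell}\mu_kq_{k\ell}\log\frac{T_{k\ell}}{q_{k\ell}},$$ where a term with $\mu_kq_{k\ell}=0$ is $0$, and a term with $\mu_kq_{k\ell}>0$ and $T_{k\ell}=0$ is $-\infty$.
   Formalization: The printed formula fails when the shift period π₀>1 (e.g. Φ(ξ)(x)=1−ξ(x+1), η=0), since edge labels describe π₀ steps; the formal statement multiplies the triple supremum by 1/π₀ and replaces P_α by P_{π₀α}, agreeing with the printed one for π₀=1. *)

(* Defs.v *)
From mathcomp Require Import all_boot all_order all_algebra.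
From mathcomp Require Import all_classical all_reals all_analysis.
Import Order.TTheory GRing.Theory Num.Theory.
Import numFieldNormedType.Exports.

Set Implicit Arguments.
Unset Strict Implicit.
Unset Printing Implicit Defensive.

Local Open Scope classical_set_scope.
Local Open Scope ring_scope.

Definition config := int -> bool.

Record binary_ca := BinaryCA {
  nbhd : seq int;
  nbhd_uniq : uniq nbhd;
  local_rule : (size nbhd).-tuple bool -> bool }.

Definition global_map (A : binary_ca) (xi : config) : config :=
  fun x => local_rule (map_tuple (fun v => xi (x + v)) (in_tuple (nbhd A))).

Definition trajectory (A : binary_ca) (xi0 : config) (t : nat) : config :=
  iter t (global_map A) xi0.

Definition flip (xi : config) (y : int) : config :=
  fun x => if x == y then ~~ xi x else xi x.

Definition change (A : binary_ca) (xi : config) (y x : int) : nat :=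
  global_map A (flip xi y) x != global_map A xi x.

Fixpoint defect (A : binary_ca) (xi0 : config) (D0 : int -> nat) (t : nat) :
    int -> nat :=
  if t is s.+1 then
    fun x => (\sum_(v <- nbhd A)
      change A (trajectory A xi0 s) (x + v)%R x
        * defect A xi0 D0 s (x + v)%R)%N
  else D0.

Definition defect_config (D0 : int -> nat) : Prop :=
  (exists x, D0 x <> 0%N) /\ finite_set [set x | D0 x <> 0%N].

Lemma finite_defect (A : binary_ca) (xi0 : config) (D0 : int -> nat) (t : nat) :
  finite_set [set x | D0 x <> 0%N] ->
  finite_set [set x | defect A xi0 D0 t x <> 0%N].
Proof.
move=> fD0; elim: t => [//|t IH] /=.
apply: (@sub_finite_set _ _ (\bigcup_(v in [set` nbhd A])
   ((fun y => y - v) @` [set x | defect A xi0 D0 t x <> 0%N]))); last first.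
  by apply: bigcup_finite => // v _; exact: finite_image.
move=> x /= Hx; apply: contrapT => H; apply: Hx.
rewrite big_seq big1// => v vA.
have [->|nz] := eqVneq (defect A xi0 D0 t (x + v)) 0%N; first by rewrite muln0.
exfalso; apply: H; exists v => //=; exists (x + v); first exact/eqP.
by rewrite addrK.
Qed.

Section lyapunov_profile.
Context {R : realType} (A : binary_ca) (xi0 : config) (D0 : int -> nat).

(* A genuine finite sum, by finite_defect. *)
Definition defect_count (alpha eps : R) (t : nat) : R :=
  \sum_(x \in [set x : int | `|x%:~R / t%:R - alpha| < eps])
    ((defect A xi0 D0 t x)%:R : R).

(* lne 0 = -oo; the junk value at t = 0 does not affect the limits. *)
Definition growth_rate (alpha eps : R) (t : nat) : \bar R :=
  ((t%:R^-1)%:E * lne (defect_count alpha eps t)%:E)%E.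

(* The limits exist in \bar R because the windows decrease with eps. *)
Definition lyapunov (alpha : R) : \bar R :=
  lim (limn_esup (growth_rate alpha eps) @[eps --> 0^'+]).

Definition lyapunov_inf (alpha : R) : \bar R :=
  lim (limn_einf (growth_rate alpha eps) @[eps --> 0^'+]).

Definition lyapunov_proper : Prop :=
  forall alpha : R, lyapunov_inf alpha = lyapunov alpha.

End lyapunov_profile.

Definition smallest (P : nat -> Prop) (n : nat) : Prop :=
  P n /\ forall m, P m -> (n <= m)%N.

Definition temporally_periodic (A : binary_ca) (eta : config) (p : nat) : Prop :=
  (1 <= p)%N /\ iter p (global_map A) eta =1 eta.

Definition spatially_periodic (eta : config) (sigma : nat) : Prop :=
  (1 <= sigma)%N /\ forall x : int, eta x = eta (x %% sigma%:Z)%Z.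

Definition shifts_by (A : binary_ca) (eta : config) (sigma p s : nat) : Prop :=
  [/\ (1 <= p)%N, (s < sigma)%N &
      forall x : int, iter p (global_map A) eta x = eta (x - s%:Z)].

Record doubly_periodic (A : binary_ca) (eta : config)
    (p sigma pi0 sigma0 : nat) : Prop := DoublyPeriodic {
  temporal_period : smallest (temporally_periodic A eta) p;
  spatial_period : smallest (spatially_periodic eta) sigma;
  shift_period : smallest (fun n => exists s, shifts_by A eta sigma n s) pi0;
  shift_shift : shifts_by A eta sigma pi0 sigma0 }.

Section expansion_graph.
Context (A : binary_ca) (eta : config) (sigma pi0 sigma0 : nat).

(* An edge of the expansion graph is determined by its initial vertex and its
   displacement, as distinct edges with the same origin i correspond to distinct
   sites i + D; the pair (i, D) is an edge when its size label is nonzero. *)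
Definition edge : Type := ('I_sigma * int)%type.

Definition edge_init (e : edge) : int := (e.1 : nat)%:Z.

Definition edge_disp (e : edge) : int := e.2.

Definition edge_size (e : edge) : nat :=
  defect A eta (fun x => (x == edge_init e) : nat) pi0
    (edge_init e + edge_disp e).

Definition edge_term (e : edge) : int :=
  ((edge_init e + edge_disp e - sigma0%:Z) %% sigma%:Z)%Z.

Definition edge_ordering (d : nat) (e : d.-tuple edge) : Prop :=
  uniq e /\ forall f : edge, f \in e <-> edge_size f <> 0%N.

Context {R : realType} (d : nat) (e : d.-tuple edge).

Definition expansion_matrix : 'M[R]_d :=
  \matrix_(k, l) if edge_term (tnth e k) == edge_init (tnth e l)
                 then (edge_size (tnth e k))%:R else 0.

Definition leadsto (k l : 'I_d) : Prop :=
  k = l \/ exists n : nat, 0 < (expansion_matrix ^+ n) k l.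

Definition prob_measures : set ('I_d -> R) :=
  [set mu | (forall k, 0 <= mu k) /\ \sum_k mu k = 1].

Definition prob_mean_disp (alpha : R) : set ('I_d -> R) :=
  [set mu | prob_measures mu /\
            \sum_k mu k * (edge_disp (tnth e k))%:~R = alpha].

Definition prob_chain (b : 'I_d) : set ('I_d -> R) :=
  [set mu | [/\ prob_measures mu,
     forall k, ~ leadsto b k -> mu k = 0 &
     forall k l, ~ leadsto l k -> ~ leadsto k l -> mu k * mu l = 0]].

Definition invariant_kernels (mu : 'I_d -> R) : set 'M[R]_d :=
  [set q | [/\ forall k l, 0 <= q k l,
     forall k, \sum_l q k l = 1 &
     forall l, \sum_k mu k * q k l = mu l]].

Definition entropy_rate (q : 'M[R]_d) (mu : 'I_d -> R) : \bar R :=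
  (\sum_k \sum_l
    if (mu k * q k l == 0)%R then 0
    else (mu k * q k l)%:E * lne (expansion_matrix k l / q k l)%:E)%E.

Definition initial_edges (D0 : int -> nat) : set 'I_d :=
  [set b | exists2 x : int, D0 x <> 0%N &
           edge_init (tnth e b) = (x %% sigma%:Z)%Z].

End expansion_graph.

Lemma edge_ordering_exists (A : binary_ca) (eta : config) (sigma pi0 : nat) :
  exists d (e : d.-tuple (edge sigma)), edge_ordering A eta pi0 e.
Proof.
have fin : finite_set [set f : edge sigma | edge_size A eta pi0 f <> 0%N].
  apply: (@sub_finite_set _ _ (\bigcup_(i in [set: 'I_sigma])
     ((fun x => (i, x - (i : nat)%:Z)) @` [set x | defect A eta
        (fun y => (y == (i : nat)%:Z) : nat) pi0 x <> 0%N]))); last first.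
    apply: bigcup_finite => // i _; apply: finite_image.
    apply: finite_defect; apply: (@sub_finite_set _ _ [set (i : nat)%:Z]) => //.
    by move=> x /=; case: eqP.
  move=> [i D] /= H; exists i => //=.
  by exists ((i : nat)%:Z + D) => //; rewrite addrAC subrr add0r.
case/finite_seqP: fin => r er; exists _, (in_tuple (undup r)).
split; first exact: undup_uniq.
move=> f; have -> : (f \in in_tuple (undup r)) = (f \in r) by exact: mem_undup.
by have /= -> := congr1 (fun S : set (edge sigma) => S f) er.
Qed.

(* Main.v *)
(* Over one shift period the linear defect dynamics is one step of a weighted walk
   on the edges of the expansion graph, so defect counts at time n pi0 are, up to
   bounded factors, weights of n-step walks of prescribed displacement. Between
   multiples of pi0 defects move at bounded speed and grow by a bounded factor per
   step.

   Upper bound: sort n-step walks by the matrix c of their transition counts, of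
   which there are polynomially many. Walks with the same c have equal weight, and
   equal probability under the Markov chain with transition probabilities
   c_kl / c_k; as these probabilities add up to at most 1, the total weight is at
   most exp (sum c_kl ln (T_kl c_k / c_kl)). Limit points of c / n are circulations
   whose support meets a chain of communicating classes, i.e. pairs (mu, q).

   Lower bound: for a stationary chain (mu, q), grouping its n-step walks by their
   transition counts loses only O(log n) of entropy, so the class weights W have
   average logarithm at least n H(q, mu) - O(log n). Close each class to a loop by a
   bounded connector and repeat it about M P(class) times, class after class in
   the order of reachability: this walk has the required rate and displacement by
   construction, so that no law of large numbers is needed. *)
Require Import Defs.
From mathcomp Require Import all_boot all_order all_algebra.
From mathcomp Require Import all_classical all_reals all_analysis.
From mathcomp Require Import ring lra zify.
Import Order.TTheory GRing.Theory Num.Theory.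
Import numFieldNormedType.Exports.

Local Open Scope classical_set_scope.
Local Open Scope ring_scope.

(** * Weighted walks *)

Section walks.
Context {d : nat} (tn : 'I_d -> 'I_d -> nat) (D : 'I_d -> int).

(* A step [k -> l] has weight [tn k l] and the displacement [D k] of its origin; the
   recursion splits off the first step. *)
Fixpoint walks (n : nat) (k l : 'I_d) (x : int) : nat :=
  if n is m.+1 then (\sum_j tn k j * walks m j l (x - D k)%R)%N
  else (k == l) && (x == 0).

(** Concatenation at [j]; only an inequality, as a longer walk may be elsewhere after [n] steps. *)
Lemma walks_mul n m k j l x y :
  (walks n k j x * walks m j l y <= walks (n + m) k l (x + y))%N.
Proof.
elim: n k x => [|n IH] k x /=.
  case: eqVneq => [->|_] //; case: eqVneq => [->|_] //=.
  by rewrite mul1n add0r.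
rewrite big_distrl; apply: leq_sum => i _ /=.
by rewrite -mulnA leq_mul2l addrAC IH orbT.
Qed.

(** Defects evolve by appending a period at the end, whereas [walks] recurses on the first step. *)
Lemma walksSr n k l x :
  walks n.+1 k l x = (\sum_j walks n k j (x - D j)%R * tn j l)%N.
Proof.
elim: n k x => [|n IH] k x.
  rewrite /= (bigD1 l) //= big1 ?addn0; last first.
    by move=> i /negbTE ->; rewrite muln0.
  rewrite (bigD1 k) //= big1 ?addn0; last first.
    by move=> i /negbTE; rewrite eq_sym => ->.
  by rewrite !eqxx mulnC.
rewrite [LHS]/=; under eq_bigr => j _ do rewrite -/(walks n.+1 _ _ _) IH big_distrr /=.
rewrite exchange_big; apply: eq_bigr => j _ /=.
rewrite big_distrl; apply: eq_bigr => i _ /=.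
by rewrite mulnA addrAC.
Qed.

(** A walk is its start [k] with the list [s] of later vertices, so that walks of [n] steps are
    [n]-tuples. As in [walks], the last vertex contributes no displacement. *)
Fixpoint disp (k : 'I_d) (s : seq 'I_d) : int :=
  if s is l :: s' then D k + disp l s' else 0.

Fixpoint passes (k : 'I_d) (s : seq 'I_d) (i j : 'I_d) : nat :=
  if s is l :: s' then ((k == i) && (l == j) + passes l s' i j)%N else 0%N.

Lemma sum_delta (V : pzSemiRingType) (k l : 'I_d) (f : 'I_d -> 'I_d -> V) :
  \sum_i \sum_j ((k == i) && (l == j))%:R * f i j = f k l.
Proof.
rewrite (bigD1 k) //= (bigD1 l) //= !eqxx mul1r big1 ?addr0; last first.
  by move=> j /negbTE; rewrite eq_sym => ->; rewrite mul0r.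
rewrite big1 ?addr0 // => i /negbTE; rewrite eq_sym => ->.
by rewrite big1 // => j _; rewrite mul0r.
Qed.

Lemma disp_passes k s :
  disp k s = \sum_i \sum_j (passes k s i j)%:R * D i.
Proof.
elim: s k => [|l s IH] k /=.
  by rewrite big1 // => i _; rewrite big1 // => j _; rewrite mul0r.
under eq_bigr => i _ do under eq_bigr => j _ do rewrite natrD mulrDl.
under eq_bigr => i _ do rewrite big_split.
by rewrite big_split /= (sum_delta int k l (fun i _ => D i)) -IH.
Qed.

Lemma sum_passes k s : (\sum_i \sum_j passes k s i j)%N = size s.
Proof.
elim: s k => [|l s IH] k /=.
  by rewrite big1 // => i _; rewrite big1.
under eq_bigr => i _ do rewrite big_split /=.
rewrite big_split /= IH -[(size s).+1]add1n; congr addn.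
rewrite (bigD1 k) //= (bigD1 l) //= !eqxx big1 ?addn0; last first.
  by move=> j /negbTE; rewrite eq_sym => ->.
rewrite big1 // => i /negbTE; rewrite eq_sym => ->.
by rewrite big1.
Qed.

Lemma passes_le_size k s i j : (passes k s i j <= size s)%N.
Proof.
elim: s k => [|l s IH] k //=.
by rewrite -add1n leq_add // leq_b1.
Qed.

(** Each visit is entered and left once, except at the two ends of the walk; so transition counts
    form a circulation up to an error of one per vertex. *)
Lemma passes_balance k s i :
  ((\sum_j passes k s i j) + (last k s == i) =
   (\sum_j passes k s j i) + (k == i))%N.
Proof.
elim: s k => [|l s IH] k /=; first by rewrite !big1.
rewrite !big_split /= -addnA (IH l).
have -> : (\sum_j ((k == i) && (l == j)) = (k == i))%N.
  rewrite (bigD1 l) //= eqxx andbT big1 ?addn0 // => j /negbTE.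
  by rewrite eq_sym andbC => ->.
have -> : (\sum_j ((k == j) && (l == i)) = (l == i))%N.
  by rewrite (bigD1 k) //= eqxx big1 ?addn0 // => j /negbTE; rewrite eq_sym => ->.
by rewrite addnC; congr addn; rewrite addnC.
Qed.

Context {R : realType}.

Fixpoint walk_prod (M : 'I_d -> 'I_d -> R) (k : 'I_d) (s : seq 'I_d) : R :=
  if s is l :: s' then M k l * walk_prod M l s' else 1.

Lemma walk_prod_passes M k s :
  walk_prod M k s = \prod_i \prod_j M i j ^+ passes k s i j.
Proof.
elim: s k => [|l s IH] k /=.
  by rewrite big1 // => i _; rewrite big1.
under eq_bigr => i _ do under eq_bigr => j _ do rewrite exprD.
under eq_bigr => i _ do rewrite big_split.
rewrite big_split /= -IH; congr *%R.
rewrite (bigD1 k) //= (bigD1 l) //= !eqxx expr1 big1 ?mulr1; last first.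
  by move=> j /negbTE; rewrite eq_sym => ->.
rewrite big1 ?mulr1 // => i /negbTE; rewrite eq_sym => ->.
by rewrite big1.
Qed.

Lemma walk_prod_ge0 M k s : (forall i j, 0 <= M i j) -> 0 <= walk_prod M k s.
Proof. by move=> M0; elim: s k => [|l s IH] k //=; rewrite mulr_ge0. Qed.

Lemma walk_prod_gt0 M k s : (forall i j, 0 <= M i j) -> 0 < walk_prod M k s ->
  forall i j, (0 < passes k s i j)%N -> 0 < M i j.
Proof.
move=> M0 + i j; elim: s k => [|l s IH] k //= Ms.
have Mkl : 0 < M k l.
  by rewrite lt_def M0 andbT; apply: contraTneq Ms => ->; rewrite mul0r ltxx.
move: Ms; rewrite pmulr_rgt0 // => Ms.
case: (k =P i) => [ki|_]; case: (l =P j) => [lj|_] /=; rewrite ?add0n; try exact: IH.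
by rewrite -ki -lj.
Qed.

Lemma sum_tuple_cons (V : nmodType) n (F : n.+1.-tuple 'I_d -> V) :
  \sum_s F s = \sum_j \sum_(s : n.-tuple 'I_d) F (cons_tuple j s).
Proof.
rewrite pair_big /= (reindex (fun p : 'I_d * n.-tuple 'I_d => cons_tuple p.1 p.2)) //=.
exists (fun t : n.+1.-tuple 'I_d => (thead t, behead_tuple t)) => [[j s] _|s _] /=.
  by congr (_, _); apply/val_inj.
by case/tupleP: s => j s; apply: val_inj.
Qed.

Local Notation T := (fun i j => (tn i j)%:R : R).

Lemma walks_tuple n k l x : (walks n k l x)%:R =
  \sum_(s : n.-tuple 'I_d | (last k s == l) && (disp k s == x)) walk_prod T k s.
Proof.
elim: n k x => [|n IH] k x.
  rewrite big_mkcond (bigD1 [tuple]) //= big1 ?addr0 ?[0 == x]eq_sym.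
    by case: ifP.
  by move=> s; rewrite tuple0.
rewrite big_mkcond sum_tuple_cons natr_sum; apply: eq_bigr => j _ /=.
rewrite natrM IH big_distrr [RHS]big_mkcond [LHS]big_mkcond /=; apply: eq_bigr => s _.
have -> // : (disp j s == x - D k) = (D k + disp j s == x).
by rewrite eq_sym subr_eq eq_sym addrC.
Qed.
End walks.

(** * Reachability and stationary chains *)

Section reachability.
Context {d : nat} (tn : 'I_d -> 'I_d -> nat) (D : 'I_d -> int) {R : realType}.
Local Notation T := (fun i j => (tn i j)%:R : R).
Local Notation walks := (walks tn D).

Definition reach (k l : 'I_d) : Prop := exists n x, (0 < walks n k l x)%N.

Lemma reach_refl k : reach k k.
Proof. by exists 0%N, 0; rewrite /= !eqxx. Qed.

Lemma reach_trans k j l : reach k j -> reach j l -> reach k l.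
Proof.
move=> [n [x kj]] [m [y jl]]; exists (n + m)%N, (x + y).
by apply: leq_trans (walks_mul tn D n m k j l x y); rewrite muln_gt0 kj.
Qed.

Lemma reach_edge k l : (0 < tn k l)%N -> reach k l.
Proof.
move=> kl; exists 1%N, (D k); rewrite /= (bigD1 l) //= eqxx subrr eqxx.
by rewrite muln1 ltn_addr.
Qed.

Lemma passes_mem (k : 'I_d) s i j : (0 < passes k s i j)%N -> i \in k :: s.
Proof.
elim: s k => [|l s IH] k //=; rewrite inE.
by case: (k =P i) => [-> _|_]; [rewrite eqxx|move=> /IH ->; rewrite orbT].
Qed.

(** Of two vertices on a walk the earlier reaches the later; this is the source of the chain
    condition in [prob_chain]. *)
Lemma walk_reach k s : 0 < walk_prod T k s ->
  {in k :: s, forall i, reach k i} /\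
  {in k :: s &, forall i j, reach i j \/ reach j i}.
Proof.
elim: s k => [|l s IH] k /=.
  by move=> _; split=> [i|i j]; rewrite !inE => /eqP ->; [|move=> /eqP ->];
    [|left]; exact: reach_refl.
move=> kls.
have kl : (0 < tn k l)%N.
  by rewrite lt0n; apply: contraTneq kls => ->; rewrite mul0r ltxx.
have {}/IH[IH1 IH2] : 0 < walk_prod T l s.
  by move: kls; rewrite pmulr_rgt0 // ltr0n.
have H i : i \in k :: l :: s -> reach k i.
  rewrite inE => /orP[/eqP ->|/IH1]; first exact: reach_refl.
  exact/reach_trans/reach_edge.
split => // i j; rewrite inE => /orP[/eqP ->|il]; first by move=> /H; left.
by rewrite inE => /orP[/eqP ->|jl]; [right; apply: H; rewrite inE il orbT|exact: IH2].
Qed.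

(* No mass leaves the set of vertices reachable from [j], so by balance none
   enters it either. *)
Lemma circulation_reach (nu : 'I_d -> 'I_d -> R) :
  (forall i j, 0 <= nu i j) -> (forall i, \sum_j nu i j = \sum_j nu j i) ->
  (forall i j, 0 < nu i j -> (0 < tn i j)%N) ->
  forall i j, 0 < nu i j -> reach j i.
Proof.
move=> nu0 bal nuT i j ij; apply: contrapT => nji.
pose S v := `[< reach j v >].
have out v w : S v -> ~~ S w -> nu v w = 0.
  move=> /asboolP jv /asboolPn jw; apply/eqP; apply: contrapT => /negP vw.
  apply: jw; apply: reach_trans jv _; apply: reach_edge; apply: nuT.
  by rewrite lt_def vw nu0.
have E : \sum_(v | S v) \sum_(w | ~~ S w) nu w v = 0.
  have : \sum_(v | S v) \sum_w nu v w = \sum_(v | S v) \sum_w nu w v.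
    by apply: eq_bigr => v _; rewrite bal.
  have -> : \sum_(v | S v) \sum_w nu v w = \sum_(v | S v) \sum_(w | S w) nu v w.
    apply: eq_bigr => v Sv; rewrite (bigID S) /= [X in _ + X]big1 ?addr0 //.
    by move=> w; exact: out.
  under [RHS]eq_bigr => v _ do rewrite (bigID S) /=.
  rewrite big_split /= [X in X = _]exchange_big /=.
  by rewrite -[X in X = _]addr0 => /addrI/esym.
have Sj : S j by apply/asboolP/reach_refl.
have nSi : ~~ S i by apply/asboolPn.
move/eqP: E; rewrite psumr_eq0; last by move=> v _; apply: sumr_ge0.
move=> /allP /(_ j); rewrite mem_index_enum Sj /= => /(_ isT).
rewrite psumr_eq0 // => /allP /(_ i); rewrite mem_index_enum nSi /= => /(_ isT).
by move/eqP => E; rewrite E ltxx in ij.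
Qed.

Lemma sum_walk_prod (q : 'I_d -> 'I_d -> R) n k :
  (forall i, \sum_j q i j = 1) ->
  \sum_(s : n.-tuple 'I_d) walk_prod q k s = 1.
Proof.
move=> q1; elim: n k => [|n IH] k.
  rewrite (bigD1 [tuple]) //= big1 ?addr0 // => s; by rewrite tuple0.
rewrite sum_tuple_cons -[RHS](q1 k); apply: eq_bigr => j _ /=.
by rewrite -big_distrr /= IH mulr1.
Qed.

(** Rows may sum to less than 1 because the empirical matrix of a walk has a zero row at each vertex
    that the walk never leaves. *)
Lemma sum_walk_prod_le1 (q : 'I_d -> 'I_d -> R) n k :
  (forall i j, 0 <= q i j) -> (forall i, \sum_j q i j <= 1) ->
  \sum_(s : n.-tuple 'I_d) walk_prod q k s <= 1.
Proof.
move=> q0 q1; elim: n k => [|n IH] k.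
  rewrite (bigD1 [tuple]) //= big1 ?addr0 // => s; by rewrite tuple0.
rewrite sum_tuple_cons; apply: le_trans (q1 k); apply: ler_sum => j _ /=.
by rewrite -big_distrr /= ler_piMr.
Qed.

(** The first step has law [mu i * q i j], and after it the chain starts afresh from [mu]; so each
    step adds the same amount to the expected counts. *)
Lemma stationary_passes (mu : 'I_d -> R) (q : 'I_d -> 'I_d -> R) n i j :
  (forall i, \sum_j q i j = 1) -> (forall l, \sum_k mu k * q k l = mu l) ->
  \sum_k \sum_(s : n.-tuple 'I_d)
     mu k * walk_prod q k s * (passes k s i j)%:R = n%:R * (mu i * q i j).
Proof.
move=> q1 inv; elim: n => [|n IH].
  rewrite mul0r big1 // => k _; rewrite big1 // => s _.
  by rewrite tuple0 /= mulr0.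
have step k : \sum_(s : n.+1.-tuple 'I_d)
     mu k * walk_prod q k s * (passes k s i j)%:R =
  \sum_l ((k == i) && (l == j))%:R * (mu k * q k l) +
  \sum_l mu k * q k l * \sum_(s : n.-tuple 'I_d)
     (walk_prod q l s * (passes l s i j)%:R).
  rewrite sum_tuple_cons -big_split; apply: eq_bigr => l _ /=.
  under eq_bigr => s _ do rewrite natrD mulrDr.
  rewrite big_split /=; congr +%R.
    rewrite -big_distrl -big_distrr -[\sum_(i0 : _) _]big_distrr /=.
    by rewrite sum_walk_prod // mulr1 mulrC.
  by rewrite big_distrr /=; apply: eq_bigr => s _; rewrite !mulrA.
rewrite (eq_bigr _ (fun k _ => step k)) big_split /= (exchange_big _ _ _ _ _ (fun k l => mu k * q k l * _)) /=.
rewrite -[n.+1]add1n natrD mulrDl mul1r -IH; congr +%R.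
  rewrite (bigD1 i) //= (bigD1 j) //= !eqxx mul1r big1 ?addr0; last first.
    by move=> l /negbTE ->; rewrite mul0r.
  rewrite big1 ?addr0 // => k /negbTE ->.
  by rewrite big1 // => l _; rewrite mul0r.
apply: eq_bigr => l _; rewrite -big_distrl /= inv big_distrr /=.
by apply: eq_bigr => s _; rewrite mulrA.
Qed.

(** By stationarity [mu i * q i j] is a circulation, so by [circulation_reach] each step can be
    undone by a walk. This allows walks of positive probability to be closed to loops. *)
Lemma stationary_return (mu : 'I_d -> R) (q : 'I_d -> 'I_d -> R) k s :
  (forall i, 0 <= mu i) -> (forall i j, 0 <= q i j) ->
  (forall i, \sum_j q i j = 1) -> (forall l, \sum_k mu k * q k l = mu l) ->
  (forall i j, 0 < mu i * q i j -> (0 < tn i j)%N) ->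
  0 < mu k -> 0 < walk_prod q k s ->
  0 < mu (last k s) /\ reach (last k s) k.
Proof.
move=> mu0 q0 q1 inv qT; elim: s k => [|l s IH] k /= mk.
  by move=> _; split=> //; exact: reach_refl.
move=> qs.
have kl : 0 < q k l.
  by rewrite lt_def q0 andbT; apply: contraTneq qs => ->; rewrite mul0r ltxx.
move: qs; rewrite pmulr_rgt0 // => qs.
have ml : 0 < mu l.
  rewrite -inv (bigD1 k) //= ltr_wpDr ?mulr_gt0 //.
  by apply: sumr_ge0 => i _; rewrite mulr_ge0.
have [mls ls] := IH _ ml qs; split => //.
apply: reach_trans ls _; apply: (circulation_reach (fun i j => mu i * q i j)) => //.
- by move=> i j; rewrite mulr_ge0.
- by move=> i; rewrite -big_distrr /= q1 mulr1 inv.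
- exact: mulr_gt0.
Qed.

End reachability.

(** * Walks sharing their transition counts *)

Section walk_types.
Context {d : nat} (tn : 'I_d -> 'I_d -> nat) (D : 'I_d -> int) {R : realType}.
Local Notation T := (fun i j => (tn i j)%:R : R).
Local Notation walks := (walks tn D).

(** Counts are at most [n], so the types form a finite type of [n.+1 ^ (d * d)] elements,
    polynomially many in [n]. *)
Definition walk_type n (k : 'I_d) (s : n.-tuple 'I_d) :
    {ffun 'I_d * 'I_d -> 'I_n.+1} :=
  [ffun p => inord (passes k s p.1 p.2)].

Lemma walk_typeE n k (s : n.-tuple 'I_d) i j :
  walk_type n k s (i, j) = passes k s i j :> nat.
Proof.
rewrite ffunE inordK // ltnS; apply: leq_trans (passes_le_size _ _ _ _) _.
by rewrite size_tuple.
Qed.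

Lemma walk_prod_type (M : 'I_d -> 'I_d -> R) n k (s s' : n.-tuple 'I_d) :
  walk_type n k s = walk_type n k s' -> walk_prod M k s = walk_prod M k s'.
Proof.
move=> E; rewrite !walk_prod_passes; apply: eq_bigr => i _; apply: eq_bigr => j _.
by rewrite -!walk_typeE E.
Qed.

(* [nu] is an unnormalised edge-pair flow; the transition probabilities it
   induces are its rows divided by their sums. *)
Definition flow_rate (nu : 'I_d -> 'I_d -> R) : R :=
  \sum_i \sum_j nu i j * (ln (T i j) - ln (nu i j / \sum_l nu i l)).

Definition passesR (k : 'I_d) s i j : R := (passes k s i j)%:R.

(** On each transition used, [T i j] is [q i j] times the exponential of the difference of their
    logarithms; on the others the exponent is 0, whatever the value of [q]. *)
Lemma walk_prod_rate k s (q := fun i j => passesR k s i j / \sum_l passesR k s i l) :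
  0 < walk_prod T k s ->
  0 < walk_prod q k s /\
  walk_prod T k s = walk_prod q k s * expR (flow_rate (passesR k s)).
Proof.
move=> Ts.
have Tp i j : (0 < passes k s i j)%N -> 0 < T i j.
  by apply: walk_prod_gt0 Ts i j => i j; exact: ler0n.
have qp i j : (0 < passes k s i j)%N -> 0 < q i j.
  move=> ij; rewrite divr_gt0 ?ltr0n //.
  rewrite (bigD1 j) //= ltr_wpDr ?ltr0n // sumr_ge0 // => l _; exact: ler0n.
split.
  rewrite walk_prod_passes; apply: prodr_gt0 => i _; apply: prodr_gt0 => j _.
  have [->|] := posnP (passes k s i j); first by rewrite expr0.
  by move=> ij; rewrite exprn_gt0 ?qp.
rewrite !walk_prod_passes expR_sum -big_split; apply: eq_bigr => i _ /=.
rewrite expR_sum -big_split; apply: eq_bigr => j _ /=.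
rewrite expRM_natl -exprMn.
have [->|ij] := posnP (passes k s i j); first by rewrite !expr0.
have := qp _ _ ij; rewrite /q => qij.
rewrite expRB !lnK ?posrE ?Tp //; congr (_ ^+ _).
by rewrite mulrC divfK // gt_eqF.
Qed.

(** Under the empirical matrix of [s0], walks of its type share one ratio of weight to probability,
    and the probabilities sum to at most 1. *)
Lemma walk_class_bound n k (s0 : n.-tuple 'I_d) : 0 < walk_prod T k s0 ->
  \sum_(s : n.-tuple 'I_d | walk_type n k s == walk_type n k s0) walk_prod T k s
   <= expR (flow_rate (passesR k s0)).
Proof.
move=> Ts0; set q := fun i j => passesR k s0 i j / \sum_l passesR k s0 i l.
have [q0 Tq] := walk_prod_rate k s0 Ts0.
have qge0 i j : 0 <= q i j.
  by rewrite divr_ge0 ?ler0n // sumr_ge0 // => l _; exact: ler0n.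
rewrite (eq_bigr (fun s => walk_prod q k (s : n.-tuple _) * expR (flow_rate (passesR k s0)))).
  rewrite -big_distrl /= ler_piMl ?expR_ge0 //.
  apply: (@le_trans _ _ (\sum_(s : n.-tuple 'I_d) walk_prod q k s)).
    rewrite [leRHS](bigID (fun s => walk_type n k s == walk_type n k s0)) /=.
    by rewrite lerDl sumr_ge0 // => s _; exact: walk_prod_ge0.
  apply: sum_walk_prod_le1 => // i; rewrite -big_distrl /=.
  have [->|nz] := eqVneq (\sum_l passesR k s0 i l) 0; first by rewrite mul0r.
  by rewrite divff.
by move=> s /eqP ss0; rewrite !(walk_prod_type _ _ _ _ _ ss0).
Qed.

(** [s] has the largest rate among the counted walks of positive weight; each of the
    [n.+1 ^ (d * d)] types then contributes at most the exponential of that rate. *)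
Lemma walks_le_rate n b l x : (0 < walks n b l x)%N ->
  exists s : n.-tuple 'I_d, [/\ disp D b s = x, 0 < walk_prod T b s &
   (walks n b l x)%:R <= (n.+1 ^ (d * d))%:R * expR (flow_rate (passesR b s))].
Proof.
move=> Wp; pose P (s : n.-tuple 'I_d) :=
  [&& last b s == l, disp D b s == x & 0 < walk_prod T b s].
have Tge0 (s : seq 'I_d) : 0 <= walk_prod T b s.
  by apply: walk_prod_ge0 => i j; exact: ler0n.
have WE : (walks n b l x)%:R = \sum_(s | P s) walk_prod T b s.
  rewrite walks_tuple big_mkcond [RHS]big_mkcond; apply: eq_bigr => s _.
  rewrite /P; case: eqP => //= _; case: eqP => //= _.
  have := Tge0 s; rewrite le_eqVlt => /orP[/eqP <-|->//].
  by rewrite ltxx.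
have [s0 Ps0] : exists s, P s.
  apply: contrapT => nP.
  suff : 0 < (walks n b l x)%:R :> R by rewrite WE big1 ?ltxx // => s Ps; case: nP; exists s.
  by rewrite ltr0n.
pose F s := flow_rate (passesR b (s : n.-tuple 'I_d)).
case: (@Order.TotalTheory.arg_maxP _ _ _ s0 P F Ps0) => s Ps sm.
exists s; case/and3P: (Ps) => _ /eqP xs Ts; split => //.
rewrite WE (partition_big (walk_type n b) predT) //=.
have -> : (n.+1 ^ (d * d))%:R = \sum_(t : {ffun 'I_d * 'I_d -> 'I_n.+1}) (1 : R).
  by rewrite sumr_const card_ffun card_prod !card_ord.
rewrite big_distrl /=; apply: ler_sum => t _; rewrite mul1r.
have [[s1 /andP[Ps1 /eqP ts1]]|no] := pselect (exists s1, P s1 && (walk_type n b s1 == t)).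
  case/and3P: (Ps1) => _ _ Ts1.
  apply: (le_trans _ (_ : expR (F s1) <= _)); last by rewrite ler_expR; exact: sm.
  apply: le_trans (walk_class_bound _ _ _ Ts1); rewrite ts1.
  rewrite big_mkcond [leRHS]big_mkcond /=; apply: ler_sum => s2 _.
  by case: (P s2) => //=; case: ifP.
by rewrite big1 ?expR_ge0 // => s1 Ps1; case: no; exists s1.
Qed.

(** Only 0 is delicate: [ln] vanishes on nonpositive reals, and from the right ln z <= z at z = 1 /
    sqrt y gives |y ln y| <= 2 sqrt y. *)
Lemma continuous_xlnx : continuous (fun x : R => x * ln x).
Proof.
move=> x; have [x0|x0|->] := ltgtP x 0.
- rewrite /continuous_at ln0 ?mulr0 ?ltW //; apply: cvg_near_cst.
  near=> y; rewrite ln0 ?mulr0 //.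
  by apply: ltW; near: y; exact: lt_nbhsl.
- by apply: cvgM; [exact: cvg_id|exact: continuous_ln].
rewrite /continuous_at mul0r; apply/cvgrPdist_lt => e e0; near=> y.
rewrite sub0r normrN.
have [y0|y0] := leP y 0; first by rewrite ln0 // mulr0 normr0.
have y1 : y < 1 by near: y; apply: lt_nbhsl; exact: ltr01.
rewrite ltr0_norm; last by rewrite nmulr_llt0 ?ln_lt0 ?y0.
have sy : 0 < Num.sqrt y by rewrite sqrtr_gt0.
have ys : Num.sqrt y * Num.sqrt y = y by rewrite -expr2 sqr_sqrtr // ltW.
have l1 : - ln y <= 2 / Num.sqrt y.
  rewrite -{1}ys lnM ?posrE // opprD.
  have := ln_sublinear (_ : 0 < (Num.sqrt y)^-1).
  rewrite invr_gt0 sy lnV ?posrE // => /(_ isT) H; lra.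
have l2 : - (y * ln y) <= 2 * Num.sqrt y.
  rewrite -mulrN; apply: le_trans (ler_wpM2l (ltW y0) l1) _.
  by rewrite -{1}ys mulrCA -!mulrA mulrCA divff ?mulr1 ?gt_eqF // mulrC.
apply: le_lt_trans l2 _.
have : Num.sqrt y < e / 2.
  have -> : e / 2 = Num.sqrt ((e / 2) ^+ 2) by rewrite sqrtr_sqr gtr0_norm // divr_gt0.
  rewrite ltr_sqrt ?exprn_gt0 ?divr_gt0 //.
  by near: y; apply: lt_nbhsl; rewrite exprn_gt0 ?divr_gt0.
by rewrite ltr_pdivlMr // mulrC.
Unshelve. all: by end_near. Qed.

(** Removes the quotient: what remains is linear or of the form x ln x, hence continuous even where
    a row of the flow vanishes. *)
Lemma flow_rateE nu : (forall i j, 0 <= nu i j) ->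
  flow_rate nu = \sum_i \sum_j (nu i j * ln (T i j) - nu i j * ln (nu i j)) +
                 \sum_i (\sum_j nu i j) * ln (\sum_j nu i j).
Proof.
move=> nu0; rewrite /flow_rate -big_split; apply: eq_bigr => i _ /=.
rewrite big_distrl -big_split; apply: eq_bigr => j _ /=.
have [->|nz] := eqVneq (nu i j) 0; first by rewrite !mul0r subr0 addr0.
have ij : 0 < nu i j by rewrite lt_def nz nu0.
have si : 0 < \sum_j nu i j.
  by rewrite (bigD1 j) //= ltr_wpDr // sumr_ge0.
by rewrite ln_div ?posrE //; ring.
Qed.

(** Scaling leaves the transition probabilities unchanged, so the rate of a walk per step is the
    rate of its normalised counts. *)
Lemma flow_rate_homo nu c : c != 0 ->
  flow_rate (fun i j => nu i j / c) = flow_rate nu / c.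
Proof.
move=> c0; rewrite /flow_rate big_distrl; apply: eq_bigr => i _ /=.
rewrite !big_distrl; apply: eq_bigr => j _ /=.
rewrite -big_distrl /= mulrAC; congr (_ * (_ - ln _) / _).
have [->|si] := eqVneq (\sum_l nu i l) 0; first by rewrite !(mul0r, invr0, mulr0).
by rewrite invfM invrK mulrACA mulVf // mulr1.
Qed.

Lemma cvg_flow_rate (u : nat -> 'I_d -> 'I_d -> R) (nu : 'I_d -> 'I_d -> R) :
  (forall m i j, 0 <= u m i j) ->
  (forall i j, u m i j @[m --> \oo] --> nu i j) ->
  flow_rate (u m) @[m --> \oo] --> flow_rate nu.
Proof.
move=> u0 unu.
have nu0 i j : 0 <= nu i j.
  by rewrite -(cvg_lim _ (unu i j)) //; apply: limr_ge; [apply/cvg_ex; exists (nu i j); exact: unu | exact: nearW].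
under eq_fun do rewrite flow_rateE //.
rewrite flow_rateE //.
have row i : (\sum_j u m i j) @[m --> \oo] --> \sum_j nu i j.
  by apply: cvg_big; [exact: add_continuous|] => j _; exact: unu.
have rates i : (\sum_j (u m i j * ln (T i j) - u m i j * ln (u m i j))) @[m --> \oo]
    --> \sum_j (nu i j * ln (T i j) - nu i j * ln (nu i j)).
  apply: cvg_big; [exact: add_continuous|] => j _; apply: cvgB; first exact: cvgMl (unu i j).
  exact: (cvg_comp _ _ (unu i j) (continuous_xlnx (nu i j))).
apply: cvgD; (apply: cvg_big; [exact: add_continuous|move=> i _]); first exact: rates.
exact: (cvg_comp _ _ (row i) (continuous_xlnx _)).
Qed.

(** Tychonoff on the unit cube gives a cluster point, and [phi m] is an index from [m] on that is
    within 1/(m+1) of it in every coordinate. *)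
Lemma flow_subsequence (u : nat -> 'I_d -> 'I_d -> R) :
  (forall m i j, 0 <= u m i j <= 1) ->
  exists (nu : 'I_d -> 'I_d -> R) (phi : nat -> nat), (forall m, m <= phi m)%N /\
   forall i j, u (phi m) i j @[m --> \oo] --> nu i j.
Proof.
move=> u01.
pose K : set (forall p : 'I_d * 'I_d, R) := [set f | forall p, `[0, 1]%classic (f p)].
have cK : compact (K : set (prod_topology (fun _ : 'I_d * 'I_d => R))).
  exact: (@tychonoff _ (fun _ => R) (fun _ => `[0, 1]%classic) (fun _ => @segment_compact _ _ _)).
pose v m : prod_topology (fun _ : 'I_d * 'I_d => R) := fun p => u m p.1 p.2.
have [|nu [_ clnu]] := cK (v @ \oo) _.
  by exists 0%N => // m _ p /=; rewrite in_itv; exact: u01.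
have H m : exists n, (m <= n)%N /\ forall p, `|v n p - nu p| < m.+1%:R^-1.
  have [||f [/= fm fnu]] := clnu (v @` [set n | (m <= n)%N])
    [set f | forall p, `|f p - nu p| < m.+1%:R^-1].
  - by exists m => // n /= mn; exists n.
  - apply: (@filter_forall _ _
      (fun p (f : prod_topology (fun _ : 'I_d * 'I_d => R)) =>
        `|f p - nu p| < m.+1%:R^-1) (nbhs nu)) => p.
    have B : nbhs (nu p : R) [set y : R | `|y - nu p| < m.+1%:R^-1].
      have e0 : 0 < m.+1%:R^-1 :> R by rewrite invr_gt0.
      by apply/nbhs_ballP; exists m.+1%:R^-1 => // y; rewrite -ball_normE /= distrC.
    exact: (@proj_continuous _ (fun _ : 'I_d * 'I_d => R) p nu _ B).
  by case: fm => n mn vf; exists n; split => // p; rewrite vf.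
have [phi Hphi] := choice H.
exists (fun i j => nu (i, j)), phi; split=> [m|i j]; first by case: (Hphi m).
apply/cvgrPdist_lt => e e0; near=> m.
have [_ /(_ (i, j)) /= mphi] := Hphi m.
rewrite distrC; apply: lt_trans mphi _.
by near: m; exact: near_infty_natSinv_lt (PosNum e0).
Unshelve. all: by end_near. Qed.

End walk_types.

(** * Upper bound on walk weights *)

Section walks_upper.
Context {d : nat} (tn : 'I_d -> 'I_d -> nat) (D : 'I_d -> int) {R : realType}.
Local Notation T := (fun i j => (tn i j)%:R : R).
Local Notation walks := (walks tn D).
Local Notation reach := (reach tn D).

Lemma cvgn_eventually2 (u v : nat -> R) (x y : R) :
  u m @[m --> \oo] --> x -> v m @[m --> \oo] --> y -> 0 < x -> 0 < y ->
  exists m, 0 < u m /\ 0 < v m.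
Proof.
move=> ux vy x0 y0.
have [M _ HM] := cvgr_gt _ ux _ x0; have [N _ HN] := cvgr_gt _ vy _ y0.
exists (M + N)%N; split; [apply: HM|apply: HN]; rewrite /= ?leq_addr ?leq_addl //.
Qed.

Lemma cvgn_dist_eq (u : nat -> R) (x y : R) :
  u m @[m --> \oo] --> x -> (forall m, `|u m - y| <= m.+1%:R^-1) -> x = y.
Proof.
move=> ux uy; apply: (cvg_unique _ ux) => //.
apply/cvgrPdist_lt => e e0; near=> m.
rewrite distrC; apply: le_lt_trans (uy m) _.
by near: m; exact: near_infty_natSinv_lt (PosNum e0).
Unshelve. all: by end_near. Qed.

(** The joint law [mu i * q i j] of two consecutive edges. Limits are taken in this form because [q]
    is undetermined where [mu] vanishes. *)
Record reachable_flow (b : 'I_d) (a : R) (nu : 'I_d -> 'I_d -> R) : Prop := {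
  flow_ge0 : forall i j, 0 <= nu i j;
  flow_sum1 : \sum_i \sum_j nu i j = 1;
  flow_balanced : forall i, \sum_j nu i j = \sum_j nu j i;
  flow_disp : \sum_i (\sum_j nu i j) * (D i)%:~R = a;
  flow_edges : forall i j, 0 < nu i j -> (0 < tn i j)%N;
  flow_reach : forall k, 0 < \sum_j nu k j -> reach b k;
  flow_chain : forall k l, 0 < \sum_j nu k j -> 0 < \sum_j nu l j ->
    reach k l \/ reach l k }.

(** The equations hold for the empirical flows up to errors of at most 1/(m+1); balance fails only
    at the ends of a walk. For the support conditions, what is positive in the limit is already
    positive for some finite walk. *)
Lemma empirical_flow_limit (b : 'I_d) (a : R) (s : nat -> seq 'I_d)
    (n : nat -> nat) (nu : 'I_d -> 'I_d -> R) (u := fun m i j => passesR b (s m) i j / (n m)%:R) :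
  (forall m, (m < n m)%N) -> (forall m, size (s m) = n m) ->
  (forall m, 0 < walk_prod T b (s m)) ->
  (forall m, `|(disp D b (s m))%:~R / (n m)%:R - a| <= m.+1%:R^-1) ->
  (forall i j, u m i j @[m --> \oo] --> nu i j) ->
  reachable_flow b a nu.
Proof.
move=> mn sn sT sa unu.
have n0 m : 0 < (n m)%:R :> R by rewrite ltr0n; exact: leq_ltn_trans (mn m).
have nm m : ((n m)%:R)^-1 <= m.+1%:R^-1 :> R.
  by rewrite lef_pV2 ?posrE // ler_nat mn.
have u0 m i j : 0 <= u m i j by rewrite divr_ge0 ?ler0n.
have row i : (\sum_j u m i j) @[m --> \oo] --> \sum_j nu i j.
  by apply: cvg_big; [exact: add_continuous|move=> j _; exact: unu].
have rowE m i : \sum_j u m i j = (\sum_j passes b (s m) i j)%:R / (n m)%:R.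
  by rewrite natr_sum -big_distrl.
have nu0 i j : 0 <= nu i j.
  rewrite -(cvg_lim _ (unu i j)) //; apply: limr_ge; last exact: nearW.
  by apply/cvg_ex; exists (nu i j); exact: unu.
have pos m i : 0 < \sum_j u m i j -> i \in b :: s m.
  rewrite rowE => /gt_eqF; have [j|no] := pselect (exists j, 0 < passes b (s m) i j)%N.
    by case: j => j /passes_mem.
  rewrite big1 ?mul0r ?eqxx // => j _; apply/eqP; rewrite -leqn0 leqNgt.
  by apply/negP => ij; apply: no; exists j.
split => //.
- apply: (@cvgn_dist_eq (fun m => \sum_i \sum_j u m i j)).
    by apply: cvg_big; [exact: add_continuous|move=> i _; exact: row].
  move=> m; under eq_bigr => i _ do rewrite rowE.
  rewrite -big_distrl -natr_sum /= sum_passes sn divff ?gt_eqF //.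
  by rewrite subrr normr0 invr_ge0.
- move=> i; apply/eqP; rewrite -subr_eq0; apply/eqP.
  apply: (@cvgn_dist_eq (fun m => \sum_j u m i j - \sum_j u m j i)).
    apply: cvgB; first exact: row.
    by apply: cvg_big; [exact: add_continuous|move=> j _; exact: unu].
  move=> m; apply: le_trans (nm m); rewrite subr0 rowE.
  rewrite -[X in _ - X]big_distrl -natr_sum /= -mulrBl normrM (gtr0_norm (_ : 0 < _^-1)) ?invr_gt0 //.
  rewrite ler_piMl ?invr_ge0 ?ler0n //.
  have -> : (\sum_j passes b (s m) i j)%:R - (\sum_j passes b (s m) j i)%:R =
            (b == i)%:R - (last b (s m) == i)%:R :> R.
    apply/eqP; rewrite subr_eq addrAC eq_sym subr_eq -!natrD eqr_nat.
    by rewrite passes_balance addnC.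
  by case: (last _ _ == i); case: (b == i);
    rewrite /= ?subrr ?subr0 ?sub0r ?normrN ?normr0 ?normr1.
- apply: (@cvgn_dist_eq (fun m => \sum_i (\sum_j u m i j) * (D i)%:~R)).
    apply: cvg_big; [exact: add_continuous|move=> i _].
    exact: cvgMl (row i).
  move=> m; apply: le_trans (sa m); rewrite disp_passes.
  suff -> : \sum_i (\sum_j u m i j) * (D i)%:~R =
    (\sum_i \sum_j (passes b (s m) i j)%:R * D i)%:~R / (n m)%:R by [].
  rewrite rmorph_sum big_distrl; apply: eq_bigr => i _ /=.
  rewrite rmorph_sum !big_distrl; apply: eq_bigr => j _ /=.
  by rewrite rmorphM /= mulrz_nat /u /passesR mulrAC.
- move=> i j ij; have [m [mp _]] := cvgn_eventually2 _ _ _ _ (unu i j) (unu i j) ij ij.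
  have : 0 < T i j; last by rewrite ltr0n.
  apply: (walk_prod_gt0 _ _ _ _ (sT m)) => [? ?|]; first exact: ler0n.
  by move: mp; rewrite /u pmulr_lgt0 ?invr_gt0 // ltr0n.
- move=> k kp; have [m [mp _]] := cvgn_eventually2 _ _ _ _ (row k) (row k) kp kp.
  by have [+ _] := walk_reach tn D _ _ (sT m); apply; exact: pos.
- move=> k l kp lp; have [m [mk ml]] := cvgn_eventually2 _ _ _ _ (row k) (row l) kp lp.
  by have [_] := walk_reach tn D _ _ (sT m); apply; exact: pos.
Qed.

(** Otherwise there are longer and longer walks, with mean displacement tending to [a] and rate per
    step at least [r']; a limit of their normalised counts is a reachable flow of rate at least
    [r' > r]. *)
Lemma walks_upper (b : 'I_d) (a r r' : R) :
  (forall nu, reachable_flow b a nu -> flow_rate tn nu <= r) -> r < r' ->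
  exists N delta, 0 < delta /\ forall n l x, (N <= n)%N ->
    `|x%:~R / n%:R - a| <= delta ->
    (walks n b l x)%:R <= (n.+1 ^ (d * d))%:R * expR (n%:R * r') :> R.
Proof.
move=> H rr'; apply: contrapT => no.
have bad m : exists ns : nat * seq 'I_d, [/\ (m < ns.1)%N, size ns.2 = ns.1,
    0 < walk_prod T b ns.2,
    `|(disp D b ns.2)%:~R / ns.1%:R - a| <= m.+1%:R^-1 &
    r' <= flow_rate tn (passesR b ns.2) / ns.1%:R].
  apply: contrapT => nbad; apply: no; exists m.+1, m.+1%:R^-1; split.
    by rewrite invr_gt0.
  move=> n l x mn xa; rewrite leNgt; apply/negP => big.
  have W0 : (0 < walks n b l x)%N.
    by rewrite -(ltr0n R); apply: le_lt_trans big; rewrite mulr_ge0 ?expR_ge0.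
  have [s [xs sT sr]] := @walks_le_rate _ tn D R _ _ _ _ W0.
  apply: nbad; exists (n, val s); split=> //=; rewrite ?size_tuple ?xs //.
  have := lt_le_trans big sr; rewrite ltr_pM2l; last by rewrite ltr0n expn_gt0.
  rewrite ltr_expR => /ltW; rewrite ler_pdivlMr ?(mulrC r') //.
  by rewrite ltr0n (leq_ltn_trans _ mn).
have {bad} [ns Hns] := choice bad.
pose u m i j := passesR b (ns m).2 i j / (ns m).1%:R : R.
have u01 m i j : 0 <= u m i j <= 1.
  have [mn sn _ _ _] := Hns m; have n0 : 0 < (ns m).1%:R :> R by rewrite ltr0n; exact: leq_ltn_trans mn.
  by rewrite divr_ge0 ?ler0n //= ler_pdivrMr // mul1r ler_nat -sn passes_le_size.
have [nu [phi [mphi unu]]] := flow_subsequence _ u01.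
have flow : reachable_flow b a nu.
  apply: (empirical_flow_limit b a (fun m => (ns (phi m)).2) (fun m => (ns (phi m)).1)) => // m;
    have [mn sn sT sa _] := Hns (phi m) => //.
  - exact: leq_ltn_trans mn.
  - by apply: le_trans sa _; rewrite lef_pV2 ?posrE ?ltr0n // ler_nat ltnS.
have := H _ flow; apply/negP; rewrite -ltNge.
apply: lt_le_trans rr' _.
have cv : flow_rate tn (u (phi m)) @[m --> \oo] --> flow_rate tn nu.
  by apply: cvg_flow_rate => // m i j; case/andP: (u01 (phi m) i j).
rewrite -(cvg_lim _ cv) //; apply: limr_ge; first by apply/cvg_ex; eexists; exact: cv.
apply: nearW => m; have [mn _ _ _ rate] := Hns (phi m).
rewrite flow_rate_homo // gt_eqF // ltr0n; exact: leq_ltn_trans mn.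
Qed.

End walks_upper.

(** * Types of a stationary chain *)

Section stationary_types.
Context {d : nat} (tn : 'I_d -> 'I_d -> nat) (D : 'I_d -> int) {R : realType}.
Local Notation T := (fun i j => (tn i j)%:R : R).
Local Notation walks := (walks tn D).
Local Notation reach := (reach tn D).

(** Comparison with the uniform law: ln z <= z - 1 at z = 1 / (P g * #|G|), averaged under [P]. *)
Lemma entropy_le_ln_card (G : finType) (P : G -> R) :
  (forall g, 0 <= P g) -> \sum_g P g = 1 -> - ln #|G|%:R <= \sum_g P g * ln (P g).
Proof.
move=> P0 P1.
have G0 : 0 < #|G|%:R :> R.
  rewrite ltr0n lt0n; apply/negP => /eqP/card0_eq G0.
  by move: P1; rewrite big_pred0 // => /esym/eqP; rewrite oner_eq0.
have H g : P g - #|G|%:R^-1 <= P g * ln (P g) + P g * ln #|G|%:R.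
  have [->|Pg] := eqVneq (P g) 0.
    by rewrite !mul0r addr0 sub0r oppr_le0 invr_ge0 ltW.
  have {Pg}Pg : 0 < P g by rewrite lt_def Pg P0.
  have := le_ln1Dx (_ : -1 < (P g * #|G|%:R)^-1 - 1).
  have I0 : 0 < (P g * #|G|%:R)^-1 by rewrite invr_gt0 mulr_gt0.
  rewrite [1 + _]addrC subrK lnV ?posrE ?mulr_gt0 // lnM ?posrE //.
  rewrite ltrBrDr addNr I0 => /(_ isT) /(ler_wpM2l (ltW Pg)).
  have -> : P g * ((P g * #|G|%:R)^-1 - 1) = #|G|%:R^-1 - P g.
    by field; rewrite !gt_eqF.
  lra.
have := ler_sum (index_enum G) (fun g (_ : true) => H g).
rewrite big_split /= [X in _ <= X -> _]big_split /= sumrN -big_distrl /= P1 mul1r.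
have -> : \sum_(g : G) (#|G|%:R^-1 : R) = 1.
  by rewrite sumr_const -[LHS]mulr_natr mulVf ?gt_eqF.
lra.
Qed.

Context (mu : 'I_d -> R) (q : 'I_d -> 'I_d -> R).
Context (mu0 : forall i, 0 <= mu i) (mu1 : \sum_i mu i = 1)
  (q0 : forall i j, 0 <= q i j) (q1 : forall i, \sum_j q i j = 1)
  (inv : forall l, \sum_k mu k * q k l = mu l)
  (qT : forall i j, 0 < mu i * q i j -> (0 < tn i j)%N).

Lemma stationary_support k s i j : 0 < mu k -> 0 < walk_prod q k s ->
  (0 < passes k s i j)%N -> 0 < mu i * q i j.
Proof.
elim: s k => [|l s IH] k //= mk qs.
have kl : 0 < q k l.
  by rewrite lt_def q0 andbT; apply: contraTneq qs => ->; rewrite mul0r ltxx.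
move: qs; rewrite pmulr_rgt0 // => qs.
have ml : 0 < mu l.
  rewrite -inv (bigD1 k) //= ltr_wpDr ?mulr_gt0 //.
  by apply: sumr_ge0 => m _; rewrite mulr_ge0.
case: (k =P i) => [ki|_]; case: (l =P j) => [lj|_] /=; rewrite ?add0n; try exact: IH.
by move=> _; rewrite -ki -lj mulr_gt0.
Qed.

(** The endpoints belong to the class, so that its walks share the initial factor [mu k] and one
    connector closes them all. *)
Definition walk_class n : Type := ('I_d * 'I_d * {ffun 'I_d * 'I_d -> 'I_n.+1})%type.

Definition class_of n (p : 'I_d * n.-tuple 'I_d) : walk_class n :=
  (p.1, last p.1 p.2, walk_type n p.1 p.2).

Definition class_prob n (g : walk_class n) : R :=
  \sum_(p | class_of n p == g) mu p.1 * walk_prod q p.1 p.2.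

Definition class_weight n (g : walk_class n) : R :=
  \sum_(p | class_of n p == g) walk_prod T p.1 p.2.

Definition class_disp n (g : walk_class n) : int :=
  \sum_i \sum_j (g.2 (i, j) : nat)%:R * D i.

Lemma class_prob_ge0 n g : 0 <= class_prob n g.
Proof. by apply: sumr_ge0 => p _; rewrite mulr_ge0 // walk_prod_ge0. Qed.

Lemma sum_class_prob n : \sum_g class_prob n g = 1.
Proof.
transitivity (\sum_(p : 'I_d * n.-tuple 'I_d) mu p.1 * walk_prod q p.1 p.2).
  by rewrite [RHS](partition_big (class_of n) predT).
rewrite -(pair_bigA _ (fun k (s : n.-tuple 'I_d) => mu k * walk_prod q k s)) /=.
rewrite -mu1; apply: eq_bigr => k _; rewrite -big_distrr /= sum_walk_prod //.
by rewrite mulr1.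
Qed.

(** Grouping by class keeps averages of linear functions of the counts. It is applied to the
    displacement and to ln T - ln q. *)
Lemma sum_class_passes n (f : 'I_d -> 'I_d -> R) :
  \sum_(g : walk_class n) class_prob n g *
     (\sum_i \sum_j (g.2 (i, j) : nat)%:R * f i j) =
  n%:R * \sum_i \sum_j mu i * q i j * f i j.
Proof.
transitivity (\sum_(p : 'I_d * n.-tuple 'I_d) mu p.1 * walk_prod q p.1 p.2 *
    (\sum_i \sum_j (passes p.1 p.2 i j)%:R * f i j)).
  rewrite [RHS](partition_big (class_of n) predT) //=; apply: eq_bigr => g _.
  rewrite /class_prob big_distrl; apply: eq_bigr => p /eqP <- /=.
  congr (_ * _); apply: eq_bigr => i _; apply: eq_bigr => j _.
  by rewrite walk_typeE.
rewrite -(pair_bigA _ (fun k (s : n.-tuple 'I_d) => mu k * walk_prod q k s *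
  (\sum_i \sum_j (passes k s i j)%:R * f i j))) /=.
transitivity (\sum_i \sum_j \sum_k \sum_(s : n.-tuple 'I_d)
   mu k * walk_prod q k s * (passes k s i j)%:R * f i j).
  under eq_bigr => k _ do under eq_bigr => s _ do rewrite big_distrr /=.
  under eq_bigr => k _ do rewrite exchange_big /=.
  rewrite exchange_big; apply: eq_bigr => i _ /=.
  under eq_bigr => k _ do under eq_bigr => s _ do rewrite big_distrr /=.
  under eq_bigr => k _ do rewrite exchange_big /=.
  rewrite exchange_big; apply: eq_bigr => j _ /=.
  by apply: eq_bigr => k _; apply: eq_bigr => s _; rewrite mulrA.
rewrite big_distrr; apply: eq_bigr => i _ /=.
rewrite big_distrr; apply: eq_bigr => j _ /=.
rewrite mulrA -(stationary_passes mu q n i j) // big_distrl; apply: eq_bigr => k _ /=.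
by rewrite big_distrl.
Qed.

Lemma class_weight_walks n g :
  class_weight n g <= (walks n g.1.1 g.1.2 (class_disp n g))%:R.
Proof.
have Tge0 k (s : seq 'I_d) : 0 <= walk_prod T k s.
  by apply: walk_prod_ge0 => i j; exact: ler0n.
rewrite /class_weight big_mkcond /=.
rewrite -(pair_bigA _ (fun k (s : n.-tuple 'I_d) =>
  if class_of n (k, s) == g then walk_prod T k s else 0)) /=.
rewrite (bigD1 g.1.1) //= [X in _ + X]big1 ?addr0; last first.
  move=> k kg; apply: big1 => s _; case: eqP => // E.
  by rewrite -E eqxx in kg.
rewrite walks_tuple [leRHS]big_mkcond /=; apply: ler_sum => s _.
case: eqP => [E|_]; last by case: ifP.
rewrite -{3}E /= eqxx /= disp_passes.
suff -> : class_disp n g = \sum_i \sum_j (passes g.1.1 s i j)%:R * D i.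
  by rewrite eqxx.
apply: eq_bigr => i _; apply: eq_bigr => j _.
by rewrite -{1}E /= walk_typeE.
Qed.

(* Walks in one class have equal weights and equal probabilities, so [W / P] is the
   common quotient [T / (mu q)], an exponential of a linear function of the counts. *)
Lemma class_ln_weight n g (f := fun i j => ln (T i j) - ln (q i j)) :
  0 < class_prob n g ->
  [/\ 0 < mu g.1.1, reach g.1.2 g.1.1, 0 < class_weight n g &
   ln (class_prob n g) + (\sum_i \sum_j (g.2 (i, j) : nat)%:R * f i j)
     <= ln (class_weight n g)].
Proof.
move=> gp.
have [p0 [/eqP p0g p0p]] : exists p, class_of n p == g /\
    0 < mu p.1 * walk_prod q p.1 p.2.
  apply: contrapT => no; move: gp; rewrite /class_prob big1 ?ltxx // => p pg.
  apply/eqP; apply: contrapT => /negP nz; apply: no; exists p; split => //.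
  by rewrite lt_def nz mulr_ge0 // walk_prod_ge0.
set k := g.1.1; have kE : p0.1 = k by rewrite /k -p0g.
rewrite kE in p0p.
have mk : 0 < mu k.
  by rewrite lt_def mu0 andbT; apply: contraTneq p0p => ->; rewrite mul0r ltxx.
have qs : 0 < walk_prod q k p0.2 by move: p0p; rewrite pmulr_rgt0.
have sup i j : (0 < passes k p0.2 i j)%N -> 0 < q i j /\ 0 < T i j.
  move=> ij; have ijp := stationary_support _ _ _ _ mk qs ij.
  split; last by rewrite ltr0n; exact: qT.
  rewrite lt_def q0 andbT; apply: contraTneq ijp => ->; by rewrite mulr0 ltxx.
set S := \sum_i \sum_j _.
have SE : S = \sum_i \sum_j (passes k p0.2 i j)%:R * f i j.
  apply: eq_bigr => i _; apply: eq_bigr => j _.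
  by rewrite -{1}p0g /= walk_typeE kE.
have TE : walk_prod T k p0.2 = walk_prod q k p0.2 * expR S.
  rewrite SE !walk_prod_passes expR_sum -big_split; apply: eq_bigr => i _ /=.
  rewrite expR_sum -big_split; apply: eq_bigr => j _ /=.
  rewrite expRM_natl -exprMn.
  have [->|ij] := posnP (passes k p0.2 i j); first by rewrite !expr0.
  have [qij Tij] := sup _ _ ij.
  by rewrite /f expRB !lnK ?posrE // mulrC divfK // gt_eqF.
have cls p : class_of n p == g -> p.1 = k /\ walk_type n k p.2 = walk_type n k p0.2.
  move=> /eqP pg; have pk : p.1 = k by rewrite /k -pg.
  split=> //; have := congr1 snd pg; rewrite -p0g /= pk kE; exact.
have WE : class_weight n g = class_prob n g * ((mu k)^-1 * expR S).
  rewrite /class_weight /class_prob big_distrl; apply: eq_bigr => p /cls[-> st] /=.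
  rewrite (walk_prod_type T _ _ _ _ st) (walk_prod_type q _ _ _ _ st) TE.
  by field; rewrite gt_eqF.
have mk1 : mu k <= 1.
  rewrite -mu1 (bigD1 k) //= lerDl; exact: sumr_ge0.
split => //.
- rewrite -p0g /= kE.
  by have [] := stationary_return tn D mu q k p0.2 mu0 q0 q1 inv qT mk qs.
- by rewrite WE mulr_gt0 // mulr_gt0 ?invr_gt0 ?expR_gt0.
rewrite WE lnM ?posrE ?mulr_gt0 ?invr_gt0 ?expR_gt0 //.
rewrite lnM ?posrE ?invr_gt0 ?expR_gt0 // expRK lerD2l lerDr lnV ?posrE //.
by rewrite oppr_ge0 ln_le0.
Qed.

(** The average of [w] is at least that of [ln P] plus [n] times the entropy rate, and the former is
    at least [- ln #|G|], a loss logarithmic in [n]. *)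
Lemma stationary_types n : exists (G : finType) (P w : G -> R) (src dst : G -> 'I_d)
    (x : G -> int),
  [/\ #|G| = (d * d * n.+1 ^ (d * d))%N /\
     (forall g, 0 <= P g) /\ \sum_g P g = 1,
   forall g, 0 < P g -> 0 < mu (src g) /\ reach (dst g) (src g),
   forall g, 0 < P g -> expR (w g) <= (walks n (src g) (dst g) (x g))%:R,
   \sum_g P g * (x g)%:~R = n%:R * \sum_i mu i * (D i)%:~R &
   n%:R * (\sum_i \sum_j mu i * q i j * (ln (T i j) - ln (q i j))) - ln #|G|%:R
     <= \sum_g P g * w g].
Proof.
exists ('I_d * 'I_d * {ffun 'I_d * 'I_d -> 'I_n.+1})%type, (class_prob n),
  (fun g => ln (class_weight n g)), (fun g => g.1.1), (fun g => g.1.2), (class_disp n).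
split.
- split; last by split; [exact: class_prob_ge0|exact: sum_class_prob].
  by rewrite !card_prod card_ffun card_prod !card_ord.
- by move=> g /class_ln_weight[].
- move=> g /class_ln_weight[_ _ gw _]; rewrite lnK ?posrE //.
  exact: class_weight_walks.
- have := sum_class_passes n (fun i _ => (D i)%:~R); under [X in _ = _ * X -> _]eq_bigr => i _.
    rewrite -big_distrl -big_distrr /= q1 mulr1; over.
  move=> <-; apply: eq_bigr => g _; congr (_ * _).
  rewrite rmorph_sum; apply: eq_bigr => i _ /=.
  rewrite rmorph_sum; apply: eq_bigr => j _ /=.
  by rewrite rmorphM /= mulrz_nat.
rewrite -sum_class_passes.
have := entropy_le_ln_card _ _ (class_prob_ge0 n) (sum_class_prob n).
rewrite -(lerD2l (\sum_(g : walk_class n) class_prob n g * (\sum_i \sum_j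
  (g.2 (i, j) : nat)%:R * (ln (T i j) - ln (q i j))))) => /le_trans; apply.
rewrite -big_split; apply: ler_sum => g _ /=.
rewrite -mulrDr; have := class_prob_ge0 n g.
rewrite le_eqVlt => /orP[/eqP <-|gp]; first by rewrite !mul0r.
by rewrite ler_pM2l // addrC; have [] := class_ln_weight _ _ gp.
Qed.

End stationary_types.

(** * Lower bound on walk weights *)

Section walks_lower.
Context {d : nat} (tn : 'I_d -> 'I_d -> nat) (D : 'I_d -> int) {R : realType}.
Local Notation T := (fun i j => (tn i j)%:R : R).
Local Notation walks := (walks tn D).
Local Notation reach := (reach tn D).

Lemma walks_pow n k x m : (walks n k k x ^ m <= walks (m * n) k k (x *+ m))%N.
Proof.
elim: m => [|m IH]; first by rewrite expn0 mul0n mulr0n /= !eqxx.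
rewrite expnS mulSn mulrS; apply: leq_trans (walks_mul _ _ _ _ _ k _ _ _).
by rewrite leq_mul2l IH orbT.
Qed.

(* The connectors, hence [c], [y] and [l], do not depend on the repetitions [m]. *)
Lemma walks_chain (G : Type) (src : G -> 'I_d) (ns : G -> nat) (xs : G -> int) b gs :
  path (fun k l => `[< reach k l >]) b (map src gs) ->
  exists c y l, forall m : G -> nat,
    (\prod_(g <- gs) walks (ns g) (src g) (src g) (xs g) ^ m g <=
     walks (c + \sum_(g <- gs) m g * ns g) b l (y + (\sum_(g <- gs) xs g *+ m g)%R)%R)%N.
Proof.
elim: gs b => [|g gs IH] b /=.
  by move=> _; exists 0%N, 0, b => m; rewrite !big_nil addn0 addr0 /= !eqxx.
case/andP=> /asboolP[n [x bg]] /IH[c [y [l H]]].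
exists (n + c)%N, (x + y), l => m; rewrite !big_cons.
have -> : (n + c + (m g * ns g + \sum_(j <- gs) m j * ns j) =
  n + (m g * ns g + (c + \sum_(j <- gs) m j * ns j)))%N by ring.
have -> : x + y + (xs g *+ m g + \sum_(j <- gs) xs j *+ m j) =
  x + (xs g *+ m g + (y + \sum_(j <- gs) xs j *+ m j)) by ring.
apply: leq_trans (walks_mul _ _ _ _ _ (src g) _ _ _).
rewrite -[leqLHS]mul1n leq_mul //.
apply: leq_trans (walks_mul _ _ _ _ _ (src g) _ _ _).
by rewrite leq_mul // walks_pow.
Qed.

Lemma archi_gt (x : R) : exists N : nat, forall n, (N <= n)%N -> x < n%:R.
Proof.
exists (Num.bound x) => n nN.
apply: le_lt_trans (ler_norm x) _; apply: lt_le_trans (archi_boundP (normr_ge0 x)) _.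
by rewrite ler_nat; apply: leq_trans nN; rewrite /Num.bound normr_id.
Qed.

(** Rounding down changes the sum by at most the sum of |f|, while the unrounded sum grows linearly
    in [n]. *)
Lemma floor_sum_gt0 (G : finType) (P f : G -> R) :
  (forall g, 0 <= P g) -> 0 < \sum_g P g * f g ->
  exists N : nat, forall n, (N <= n)%N ->
    0 < \sum_g (Num.truncn (n%:R * P g))%:R * f g.
Proof.
move=> P0 S0; set S := \sum_g _ in S0.
have [N HN] := archi_gt ((\sum_g `|f g|) / S).
exists N => n /HN; rewrite ltr_pdivrMr // => nS.
suff : n%:R * S - \sum_g (Num.truncn (n%:R * P g))%:R * f g <= \sum_g `|f g| by lra.
rewrite /S big_distrr -sumrB; apply: ler_sum => g _ /=.
rewrite mulrA -mulrBl; apply: le_trans (ler_norm _) _.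
rewrite normrM ler_piMl //.
have /Num.Theory.truncn_itv/andP[h1 h2] : 0 <= n%:R * P g by rewrite mulr_ge0.
by rewrite ger0_norm ?subr_ge0 // lerBlDl -natr1 in h2 *; exact: ltW.
Qed.

Lemma natS_le_expR (e : R) : 0 < e ->
  exists N : nat, forall n, (N <= n)%N -> n.+1%:R <= expR (e * n%:R).
Proof.
(* Beyond 2 / e^2 the quadratic term (e n)^2 / 2 of the exponential series dominates [n]. *)
move=> e0; have [N HN] := archi_gt (2 / e ^+ 2).
exists N => n /HN; rewrite ltr_pdivrMr ?exprn_gt0 // => ne.
have en : 0 <= e * n%:R by rewrite mulr_ge0 // ltW.
apply: le_trans (expR_ge1Dxn 1 en); rewrite -natr1 addrC lerD2l.
rewrite ler_pdivlMr ?ltr0n //.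
have -> : (e * n%:R) ^+ 2 = n%:R * (n%:R * e ^+ 2) by ring.
by apply: ler_wpM2l => //; exact: ltW.
Qed.

Context (mu : 'I_d -> R) (q : 'I_d -> 'I_d -> R)
  (mu0 : forall i, 0 <= mu i) (mu1 : \sum_i mu i = 1)
  (q0 : forall i j, 0 <= q i j) (q1 : forall i, \sum_j q i j = 1)
  (inv : forall l, \sum_k mu k * q k l = mu l)
  (qT : forall i j, 0 < mu i * q i j -> (0 < tn i j)%N).

Definition mean_disp : R := \sum_i mu i * (D i)%:~R.

Definition chain_rate : R :=
  \sum_i \sum_j mu i * q i j * (ln (T i j) - ln (q i j)).

(** The connectors closing the classes have length and displacement bounded independently of [n], so
    for large [n] they hardly change the averages. The claims are strict inequalities between
    averages, the form that [floor_sum_gt0] carries over to integer multiplicities. *)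
Lemma stationary_loops (h e : R) : h < chain_rate -> 0 < e ->
  exists (G : finType) (P w : G -> R) (src : G -> 'I_d) (ns : G -> nat) (xs : G -> int),
  [/\ forall g, 0 <= P g,
   forall g, 0 < P g -> 0 < mu (src g) /\
      expR (w g) <= (walks (ns g) (src g) (src g) (xs g))%:R,
   0 < \sum_g P g * (ns g)%:R,
   0 < \sum_g P g * (w g - h * (ns g)%:R) &
   0 < \sum_g P g * (e * (ns g)%:R - ((xs g)%:~R - mean_disp * (ns g)%:R)) /\
   0 < \sum_g P g * (e * (ns g)%:R + ((xs g)%:~R - mean_disp * (ns g)%:R))].
Proof.
move=> hH e0.
have [cn Hcn] : exists cn : 'I_d * 'I_d -> nat * int, forall p, reach p.1 p.2 ->
    (0 < walks (cn p).1 p.1 p.2 (cn p).2)%N.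
  have /choice[cn Hcn] : forall p : 'I_d * 'I_d, exists c : nat * int,
      reach p.1 p.2 -> (0 < walks c.1 p.1 p.2 c.2)%N.
    move=> p; have [[n [x nx]]|no] := pselect (reach p.1 p.2).
      by exists (n, x).
    by exists (0%N, 0).
  by exists cn.
pose C1 : R := \sum_p (cn p).1%:R; pose C2 : R := \sum_p `|(cn p).2%:~R|.
have C1b p : (cn p).1%:R <= C1.
  by rewrite /C1 (bigD1 p) //= lerDl sumr_ge0.
have C2b p : `|(cn p).2%:~R| <= C2.
  by rewrite /C2 (bigD1 p) //= lerDl sumr_ge0.
set H := chain_rate in hH *; set a := mean_disp.
pose dd : R := (d * d)%:R.
have dd0 : 0 <= dd by exact: ler0n.
(* With this [t] the term [d * d * ln n.+1] of [ln #|G|] costs at most half of the gap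
   [n * (H - h)]. [N2] fits the constants and the connectors into the other half; [N3] keeps the
   drift of the connectors below [n * e]. *)
pose t := (H - h) / (2 * (dd + 1)).
have t0 : 0 < t by rewrite divr_gt0 ?mulr_gt0 ?subr_gt0 ?ltr_wpDl.
have [N1 HN1] := natS_le_expR _ t0.
have [N2 HN2] := archi_gt (2 * (ln dd + `|h| * C1) / (H - h)).
have [N3 HN3] := archi_gt ((C2 + `|a| * C1) / e).
pose n := (N1 + N2 + N3).+1.
have {}HN1 := HN1 n (_ : (N1 <= n)%N).
have {HN1} nt : n.+1%:R <= expR (t * n%:R) by apply: HN1; rewrite /n; lia.
have {}HN2 : 2 * (ln dd + `|h| * C1) < n%:R * (H - h).
  by rewrite -ltr_pdivrMr ?subr_gt0 // HN2 // /n; lia.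
have {}HN3 : C2 + `|a| * C1 < n%:R * e.
  by rewrite -ltr_pdivrMr // HN3 // /n; lia.
have [G [P [w [src [dst [x [[cG [P0 P1]] Preach Pw Px Pent]]]]]]] :=
  stationary_types tn D mu q mu0 mu1 q0 q1 inv qT n.
have sumP (f : G -> R) (c : R) : \sum_g P g * (c + f g) = c + \sum_g P g * f g.
  under eq_bigr => g _ do rewrite mulrDr.
  by rewrite big_split /= -big_distrl /= P1 mul1r.
have sumPb (f : G -> R) (c : R) : (forall g, f g <= c) -> \sum_g P g * f g <= c.
  move=> fc; rewrite -[leRHS]mul1r -P1 big_distrl /=; apply: ler_sum => g _.
  exact: ler_wpM2l.
exists G, P, w, src, (fun g => n + (cn (dst g, src g)).1)%N,
  (fun g => x g + (cn (dst g, src g)).2).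
have lnG : ln #|G|%:R <= ln dd + n%:R * ((H - h) / 2).
  have tn0 : 0 <= t * n%:R by rewrite mulr_ge0 // ltW.
  have tE : t * (2 * (dd + 1)) = H - h.
    by rewrite divfK // mulf_neq0 ?gt_eqF // ltr_wpDl.
  have hn : 0 <= n%:R * ((H - h) / 2) by rewrite -tE; move: (mulr_ge0 dd0 tn0); lra.
  have [dd_eq0|dd_gt0] := posnP (d * d).
    by rewrite cG /dd dd_eq0 mul0n ln0 // add0r.
  rewrite cG natrM lnM ?posrE ?ltr0n ?expn_gt0 // lerD2l natrX lnXn //.
  have lnn : ln n.+1%:R <= t * n%:R.
    by rewrite -(expRK (t * n%:R)) ler_ln ?posrE ?expR_gt0.
  rewrite -[leLHS]mulr_natl; apply: le_trans (ler_wpM2l dd0 lnn) _.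
  by rewrite -tE; lra.
set Pc := \sum_g P g * (cn (dst g, src g)).1%:R.
have Pc0 : 0 <= Pc by apply: sumr_ge0 => g _; rewrite mulr_ge0.
have PcC : Pc <= C1 by apply: sumPb => g; exact: C1b.
set Px2 := \sum_g P g * (cn (dst g, src g)).2%:~R.
have Px2a : Px2 <= C2 by apply: sumPb => g; apply: le_trans (C2b _); exact: ler_norm.
have Px2b : - C2 <= Px2.
  rewrite lerNl -sumrN; under eq_bigr => g _ do rewrite -mulrN.
  apply: sumPb => g; apply: le_trans (C2b (dst g, src g)); rewrite -normrN; exact: ler_norm.
have PnE : \sum_g P g * (n + (cn (dst g, src g)).1)%:R = n%:R + Pc.
  by under eq_bigr => g _ do rewrite natrD; rewrite sumP.
have PxE : \sum_g P g * (x g + (cn (dst g, src g)).2)%:~R = n%:R * a + Px2.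
  rewrite -Px -big_split; apply: eq_bigr => g _ /=.
  by rewrite rmorphD mulrDr.
have n0 : 0 < n%:R :> R by rewrite ltr0n.
have aPc : a * Pc <= `|a| * C1.
  by apply: le_trans (ler_norm _) _; rewrite normrM (ger0_norm Pc0) ler_wpM2l.
have aPcN : - (a * Pc) <= `|a| * C1.
  by apply: le_trans (ler_norm _) _; rewrite normrN normrM (ger0_norm Pc0) ler_wpM2l.
have hPc : h * Pc <= `|h| * C1.
  by apply: le_trans (ler_norm _) _; rewrite normrM (ger0_norm Pc0) ler_wpM2l.
have ePc : 0 <= e * Pc by rewrite mulr_ge0 // ltW.
split => //.
- move=> g gp; have [ms ds] := Preach _ gp; split => //.
  apply: le_trans (Pw _ gp) _; rewrite ler_nat.
  apply: leq_trans (walks_mul _ _ _ _ _ (dst g) _ _ _).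
  by rewrite -[leqLHS]muln1 leq_mul // (Hcn (dst g, src g)).
- by rewrite PnE ltr_wpDr.
- under eq_bigr => g _ do rewrite mulrBr mulrCA.
  rewrite sumrB -big_distrr /= PnE.
  move: Pent; rewrite -/chain_rate -/H; lra.
- split.
  + under eq_bigr => g _ do rewrite mulrBr mulrBr (mulrCA _ e) (mulrCA _ mean_disp).
    rewrite !sumrB -!big_distrr /= PnE PxE -/a; lra.
  + under eq_bigr => g _ do rewrite mulrDr mulrBr (mulrCA _ e) (mulrCA _ mean_disp).
    rewrite big_split /= sumrB -!big_distrr /= PnE PxE -/a; lra.
Qed.

(** Loops are repeated roughly in proportion to [P], in an order compatible with reachability. To
    lengthen the walk, each loop is repeated [j] times as often within a single pass: the last loop
    need not lead back to the first, and the connectors are paid only once. *)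
Lemma walks_lower (b : 'I_d) (h e : R) : h < chain_rate -> 0 < e ->
  (forall i, 0 < mu i -> reach b i) ->
  (forall i j, 0 < mu i -> 0 < mu j -> reach i j \/ reach j i) ->
  exists (L c : nat) (y Y : int) (Om : R) l,
   [/\ (0 < L)%N, `|Y%:~R - mean_disp * L%:R| <= e * L%:R, h * L%:R <= Om &
    forall j, expR (j%:R * Om) <= (walks (c + j * L) b l (y + Y *+ j))%:R].
Proof.
move=> hH e0 breach chain.
have [G [P [w [src [ns [xs [P0 Pw S1 S2 [S3 S4]]]]]]]] := stationary_loops h e hH e0.
have [N1 H1] := floor_sum_gt0 _ _ _ P0 S1.
have [N2 H2] := floor_sum_gt0 _ _ _ P0 S2.
have [N3 H3] := floor_sum_gt0 _ _ _ P0 S3.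
have [N4 H4] := floor_sum_gt0 _ _ _ P0 S4.
pose n := (N1 + N2 + N3 + N4)%N.
have {}H1 := H1 n ltac:(rewrite /n; lia); have {}H2 := H2 n ltac:(rewrite /n; lia).
have {}H3 := H3 n ltac:(rewrite /n; lia); have {}H4 := H4 n ltac:(rewrite /n; lia).
pose m g := Num.truncn (n%:R * P g).
(* The chain condition makes [r] total where [P] is positive, so sorting yields a path for
   [reach]. *)
pose r g g' := `[< reach (src g) (src g') >].
pose gs := sort r [seq g <- enum G | 0 < P g].
have gsP g : g \in gs -> 0 < P g by rewrite mem_sort mem_filter => /andP[].
(* The loops filtered out have [P g = 0], hence multiplicity 0. *)
have sumgs (F : G -> R) : \sum_(g <- gs) (m g)%:R * F g = \sum_g (m g)%:R * F g.
  rewrite (perm_big _ (permEl (perm_sort _ _))) /= big_filter big_enum_cond /=.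
  rewrite big_mkcond; apply: eq_bigr => g _ /=; case: ltP => // Pg.
  have Pg0 : P g = 0 by apply/eqP; rewrite eq_le Pg P0.
  by rewrite /m Pg0 mulr0 Num.Theory.truncn0 mul0r.
have pth : path (fun k l => `[< reach k l >]) b (map src gs).
  have : sorted r gs.
    apply: (@sort_sorted_in _ [pred g | 0 < P g]) => [g g' /= gp g'p|].
      have [mg _] := Pw _ gp; have [mg' _] := Pw _ g'p.
      by apply/orP; have [?|?] := chain _ _ mg mg'; [left|right]; apply/asboolP.
    by apply/allP => g; rewrite mem_filter => /andP[].
  move: (gs) gsP => [//|g gs'] gsP' /= srt; apply/andP; split.
    by apply/asboolP/breach; case: (Pw g (gsP' _ (mem_head _ _))).
  by rewrite path_map.
have [c [y [l Hc]]] := walks_chain G src ns xs b gs pth.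
pose L := (\sum_(g <- gs) m g * ns g)%N; pose Y := \sum_(g <- gs) xs g *+ m g.
pose Om := \sum_(g <- gs) (m g)%:R * w g.
have LE : L%:R = \sum_g (m g)%:R * (ns g)%:R :> R.
  by rewrite -sumgs natr_sum; apply: eq_bigr => g _; rewrite natrM.
have YE : Y%:~R = \sum_g (m g)%:R * (xs g)%:~R :> R.
  rewrite -sumgs rmorph_sum; apply: eq_bigr => g _ /=.
  by rewrite rmorphMn /= mulr_natl.
have OE : Om = \sum_g (m g)%:R * w g by rewrite -sumgs.
exists L, c, y, Y, Om, l; split.
- by rewrite -(ltr0n R) LE.
- rewrite YE LE ler_norml; apply/andP; split.
    rewrite -subr_ge0; apply: ltW; apply: lt_le_trans H4 _.
    rewrite le_eqVlt; apply/orP; left; apply/eqP.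
    under eq_bigr => g _ do rewrite mulrDr mulrBr (mulrCA _ e) (mulrCA _ mean_disp).
    by rewrite big_split sumrB -!big_distrr /= opprK addrC.
  rewrite -subr_ge0; apply: ltW; apply: lt_le_trans H3 _.
  rewrite le_eqVlt; apply/orP; left; apply/eqP.
  under eq_bigr => g _ do rewrite mulrBr mulrBr (mulrCA _ e) (mulrCA _ mean_disp).
  by rewrite !sumrB -!big_distrr.
- rewrite OE LE -subr_ge0; apply: ltW; apply: lt_le_trans H2 _.
  rewrite le_eqVlt; apply/orP; left; apply/eqP.
  under eq_bigr => g _ do rewrite mulrBr (mulrCA _ h).
  by rewrite sumrB -big_distrr.
move=> j; have := Hc (fun g => j * m g)%N.
have -> : (\sum_(g <- gs) j * m g * ns g = j * L)%N.
  by rewrite big_distrr; apply: eq_bigr => g _; rewrite /= mulnA.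
have -> : \sum_(g <- gs) xs g *+ (j * m g) = Y *+ j.
  by rewrite -sumrMnl; apply: eq_bigr => g _; rewrite mulnC mulrnA.
rewrite -(ler_nat R); apply: le_trans.
rewrite natr_prod big_distrr expR_sum big_seq [leRHS]big_seq /=.
apply: ler_prod => g /gsP gp; rewrite expR_ge0 /=.
rewrite mulrA -natrM expRM_natl natrX lerXn2r ?nnegrE ?expR_ge0 ?ler0n //.
by have [] := Pw _ gp.
Qed.

End walks_lower.

(** * Defects as walks *)

Section defect_dynamics.
Context (A : binary_ca).
Implicit Types (xi : config) (x y z a : int).

Lemma trajectoryD xi s t :
  trajectory A (trajectory A xi s) t = trajectory A xi (s + t).
Proof. by rewrite /trajectory -iterD addnC. Qed.

Lemma defectD xi D0 s t :
  defect A xi D0 (s + t) = defect A (trajectory A xi s) (defect A xi D0 s) t.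
Proof.
elim: t => [|t IH]; first by rewrite addn0.
by rewrite addnS /= IH trajectoryD.
Qed.

(** The coefficients [change] are read off the trajectory alone, so the dynamics is linear in the
    defects. *)
Lemma defect_linear xi D0 (S : seq int) t x :
  uniq S -> (forall y, D0 y <> 0%N -> y \in S) ->
  defect A xi D0 t x =
  (\sum_(y <- S) D0 y * defect A xi (fun z => z == y) t x)%N.
Proof.
move=> uS supS; elim: t x => [|t IH] x /=.
  have [xS|xS] := boolP (x \in S).
    rewrite (bigD1_seq x) //= eqxx muln1 big1 ?addn0 // => y /negbTE.
    by rewrite eq_sym => ->; rewrite muln0.
  rewrite big_seq big1 => [|y yS].
    by apply/eqP; apply: contraNT xS => /eqP /supS.
  by case: eqP => [xy|_]; [rewrite -xy (negbTE xS) in yS|rewrite muln0].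
under eq_bigr => v _ do rewrite IH big_distrr /=.
rewrite exchange_big; apply: eq_bigr => y _ /=.
by rewrite big_distrr; apply: eq_bigr => v _; rewrite /= mulnCA.
Qed.

Definition translate (T : Type) a (f : int -> T) : int -> T := fun x => f (x + a).

Lemma global_map_translate xi a :
  global_map A (translate _ a xi) = translate _ a (global_map A xi).
Proof.
apply: funext => x; rewrite /global_map /translate; congr (local_rule _).
by apply: val_inj; apply: eq_map => v; rewrite addrAC.
Qed.

Lemma trajectory_translate xi a t :
  trajectory A (translate _ a xi) t = translate _ a (trajectory A xi t).
Proof. by elim: t => [//|t IH]; rewrite /= -/(trajectory _ _ _) IH global_map_translate. Qed.

Lemma change_translate xi a y x :
  change A (translate _ a xi) y x = change A xi (y + a) (x + a).
Proof.
rewrite /change; have -> : flip (translate _ a xi) y = translate _ a (flip xi (y + a)).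
  by apply: funext => z; rewrite /flip /translate (inj_eq (addIr a)).
by rewrite !global_map_translate.
Qed.

Lemma defect_translate xi D0 a t :
  defect A (translate _ a xi) (translate _ a D0) t = translate _ a (defect A xi D0 t).
Proof.
elim: t => [//|t IH]; apply: funext => x /=; rewrite /translate.
apply: eq_bigr => v _; rewrite trajectory_translate change_translate IH.
by rewrite /translate addrAC.
Qed.

Definition ca_radius : nat := \sum_(v <- nbhd A) `|v|%N.

(* The successor makes the pigeonhole argument of [defect_step] strict, also for an
   empty neighbourhood. *)
Definition ca_branching : nat := (size (nbhd A)).+1.

(** The value at [x] is a sum over the neighbourhood, one site of which carries at least an equal
    share. *)
Lemma defect_step xi D0 t x : exists y, (`|y - x| <= ca_radius)%N /\
  (defect A xi D0 t.+1 x <= ca_branching * defect A xi D0 t y)%N.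
Proof.
set De := defect A xi D0 t.
have [->|pos] := posnP (defect A xi D0 t.+1 x).
  by exists x; rewrite subrr.
apply: contrapT => no.
have small v : v \in nbhd A ->
    (ca_branching * De (x + v)%R <= (defect A xi D0 t.+1 x).-1)%N.
  move=> vA; rewrite -ltnS prednK // ltnNge; apply/negP => big; apply: no.
  exists (x + v); split=> //; rewrite addrAC subrr add0r /ca_radius.
  by rewrite (bigD1_seq v) ?nbhd_uniq //= leq_addr.
have : (ca_branching * defect A xi D0 t.+1 x <=
    size (nbhd A) * (defect A xi D0 t.+1 x).-1)%N.
  have -> : (size (nbhd A) * (defect A xi D0 t.+1 x).-1 =
      \sum_(v <- nbhd A) (defect A xi D0 t.+1 x).-1)%N.
    by rewrite big_const_seq count_predT iter_addn_0 mulnC.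
  rewrite [X in (_ * X <= _)%N]/= big_distrr /=.
  rewrite big_seq [leqRHS]big_seq; apply: leq_sum => v vA.
  apply: leq_trans (small v vA); rewrite leq_mul2l; apply/orP; right.
  by rewrite -[leqRHS]mul1n leq_mul2r leq_b1 orbT.
rewrite /ca_branching; move: pos; case: (defect _ _ _ _ _) => // m _ /=.
by rewrite mulSn mulnS; lia.
Qed.

(** The estimate goes backwards in time, since defects may die out. The upper bound on growth steps
    from [t] back to a multiple of [pi0], the lower bound from a later multiple of [pi0] back to
    [t]. *)
Lemma defect_steps xi D0 t g x : exists y, (`|y - x| <= ca_radius * g)%N /\
  (defect A xi D0 (t + g) x <= ca_branching ^ g * defect A xi D0 t y)%N.
Proof.
elim: g x => [|g IH] x.
  by exists x; rewrite subrr addn0 expn0 mul1n.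
rewrite addnS; have [y [yx xy]] := defect_step xi D0 (t + g) x.
have [z [zy yz]] := IH y; exists z; split; first by rewrite mulnS; lia.
by apply: leq_trans xy _; rewrite expnS -mulnA leq_mul2l yz orbT.
Qed.

End defect_dynamics.

(** * Unfolding the defect dynamics onto the expansion graph *)

Section defect_walks.
Context (A : binary_ca) (eta : config) (sigma pi0 sigma0 : nat).
Context (sigma_gt0 : (0 < sigma)%N)
  (eta_mod : forall x : int, eta x = eta (x %% sigma%:Z)%Z)
  (eta_shift : forall x : int, iter pi0 (global_map A) eta x = eta (x - sigma0%:Z)).
Context (D0 : int -> nat) (fin0 : finite_set [set x | D0 x <> 0%N]).
Context (d : nat) (e : d.-tuple (edge sigma)) (He : edge_ordering A eta pi0 e).

Local Notation size_of k := (edge_size A eta pi0 (tnth e k)).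
Local Notation init k := (edge_init (tnth e k)).
Local Notation disp_of k := (edge_disp (tnth e k)).

Definition edge_weight (k l : 'I_d) : nat :=
  if edge_term sigma0 (tnth e k) == init l then size_of k else 0%N.

Definition edge_disps (k : 'I_d) : int := disp_of k.

Lemma modz_ord x : exists v : 'I_sigma, (v : nat)%:Z = (x %% sigma%:Z)%Z.
Proof.
have s0 : sigma%:Z != 0 by case: sigma sigma_gt0.
have h0 : (0 <= x %% sigma%:Z)%Z by exact: modz_ge0.
have h1 : (`|(x %% sigma%:Z)%Z| < sigma)%N.
  by rewrite -ltz_nat gez0_abs // ltz_pmod.
by exists (Ordinal h1); rewrite /= gez0_abs.
Qed.

Lemma trajectory_shift n :
  trajectory A eta (n * pi0) = translate _ (- (n * sigma0)%:Z) eta.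
Proof.
elim: n => [|n IH].
  by apply: funext => x; rewrite /translate /= oppr0 addr0.
rewrite mulSn addnC -trajectoryD IH trajectory_translate; apply: funext => x.
rewrite /translate /trajectory eta_shift; congr eta.
by rewrite mulSn PoszD; ring.
Qed.

(** After [n] shift periods the trajectory seen from [y] is [eta] seen from [v], so by translation
    covariance a unit defect at [y] spreads like one placed at [v] at time 0. *)
Lemma defect_edge n y z (v : 'I_sigma) :
  (v : nat)%:Z = ((y - (n * sigma0)%:Z) %% sigma%:Z)%Z ->
  defect A (trajectory A eta (n * pi0)) (fun x => x == y) pi0 z =
  edge_size A eta pi0 (v, z - y).
Proof.
move=> vE; pose a := (v : nat)%:Z - y.
have -> : trajectory A eta (n * pi0) = translate _ a eta.
  rewrite trajectory_shift; apply: funext => x; rewrite /translate.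
  rewrite eta_mod [RHS]eta_mod; congr eta.
  rewrite /a vE addrCA -[in RHS]modzDml modz_mod modzDml; congr (modz _ _); ring.
have -> : (fun x => (x == y) : nat) = translate _ a (fun x => (x == (v : nat)%:Z) : nat).
  apply: funext => x; rewrite /translate /a; congr nat_of_bool.
  by apply/eqP/eqP; lia.
rewrite defect_translate /translate /edge_size /edge_init /edge_disp /=.
by congr (defect _ _ _ _ _); rewrite /a addrCA.
Qed.

Lemma edge_size_sum (f : edge sigma) :
  edge_size A eta pi0 f = (\sum_j (tnth e j == f) * size_of j)%N.
Proof.
have [ue eP] := He; have [fe|/negP fe] := boolP (f \in e).
  have /tnthP[j ->] := fe.
  rewrite (bigD1 j) //= eqxx mul1n big1 ?addn0 // => i ij.
  have /tuple_uniqP/inj_eq -> := ue; by rewrite (negbTE ij).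
rewrite big1 => [|j _].
  by apply/eqP; apply: contrapT => /negP nz; apply: fe; apply/eP/eqP.
by case: eqP => // jf; case: fe; rewrite -jf mem_tnth.
Qed.

(** In the frame moving by [sigma0] per shift period, [y] lies over the vertex where edge [j]
    starts. *)
Definition at_vertex n (j : 'I_d) (y : int) : bool :=
  init j == ((y - (n * sigma0)%:Z) %% sigma%:Z)%Z.

Local Notation Delta n := (defect A eta D0 (n * pi0)).

Lemma defect_period n z :
  Delta n.+1 z = (\sum_j at_vertex n j (z - disp_of j)%R *
                    Delta n (z - disp_of j)%R * size_of j)%N.
Proof.
have [S0 S0E] : exists S : seq int, [set x | Delta n x <> 0%N] = [set` S].
  by apply/finite_seqP; exact: finite_defect.
have uS := undup_uniq S0.
have supS y : Delta n y <> 0%N -> y \in undup S0.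
  by rewrite mem_undup; have /= <- := congr1 (fun X : set int => X y) S0E.
rewrite mulSn addnC defectD (defect_linear _ _ _ _ _ _ uS supS).
have [v Hv] := choice (fun y => modz_ord (y - (n * sigma0)%:Z)).
under eq_bigr => y _ do rewrite (defect_edge n y z (v y) (Hv y)) edge_size_sum big_distrr /=.
rewrite exchange_big; apply: eq_bigr => j _ /=.
have atE y : (tnth e j == (v y, z - y)) = at_vertex n j y && (y == z - disp_of j).
  rewrite /at_vertex -Hv /edge_init /edge_disp eqz_nat.
  case: (tnth e j) => i D /=; rewrite xpair_eqE; congr (_ && _).
  by apply/eqP/eqP => ->; ring.
have [zS|zS] := boolP (z - disp_of j \in undup S0).
  rewrite (bigD1_seq (z - disp_of j)) //= atE eqxx andbT big1 ?addn0.
    by rewrite mulnA [X in (X * _)%N]mulnC.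
  by move=> y yz; rewrite atE (negbTE yz) andbF mul0n muln0.
rewrite big_seq big1 => [|y yS].
  have -> : Delta n (z - disp_of j) = 0%N.
    by apply/eqP; apply: contraNT zS => /eqP/supS.
  by rewrite muln0.
rewrite atE; case: eqP => [yz|_]; last by rewrite andbF mul0n muln0.
by rewrite -yz yS in zS.
Qed.

Lemma at_vertex_step n j l z :
  (at_vertex n.+1 l z * (at_vertex n j (z - disp_of j)%R * size_of j) =
   edge_weight j l * at_vertex n j (z - disp_of j)%R)%N.
Proof.
rewrite /edge_weight; have [atj|] := boolP (at_vertex n j _); last first.
  by rewrite !muln0.
have -> : edge_term sigma0 (tnth e j) = ((z - (n.+1 * sigma0)%:Z) %% sigma%:Z)%Z.
  rewrite /edge_term (eqP atj) -addrA modzDml; congr (modz _ _).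
  by rewrite mulSn PoszD; ring.
rewrite /at_vertex eq_sym; case: ifP => _; by rewrite ?mul1n ?mul0n ?muln1.
Qed.

(** Here [l] is the edge about to be taken from [z], its displacement not yet counted, in agreement
    with [walks]. Defects over a vertex without outgoing edges are therefore invisible. *)
Lemma defect_walks (S : seq int) n l z :
  uniq S -> (forall y, D0 y <> 0%N -> y \in S) ->
  (at_vertex n l z * Delta n z =
   \sum_(x <- S) \sum_k D0 x * at_vertex 0 k x *
     walks edge_weight edge_disps n k l (z - x)%R)%N.
Proof.
move=> uS supS; elim: n l z => [|n IH] l z.
  rewrite mul0n [defect _ _ _ 0]/= [LHS]mulnC.
  transitivity (\sum_(x <- S) (z == x) * (D0 x * at_vertex 0 l x))%N.
    have [zS|zS] := boolP (z \in S).
      rewrite (bigD1_seq z) // eqxx mul1n big1 => [|y /negbTE].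
        by rewrite [RHS]addn0.
      by rewrite eq_sym => ->.
    have -> : D0 z = 0%N by apply/eqP; apply: contraNT zS => /eqP/supS.
    rewrite mul0n big_seq big1 // => y yS.
    by case: eqP => // zy; rewrite zy yS in zS.
  apply: eq_bigr => x _; rewrite (bigD1 l) //= big1 ?addn0; last first.
    by move=> k /negbTE ->; rewrite muln0.
  by rewrite eqxx subr_eq0 /= mulnC.
under [RHS]eq_bigr => x _ do under eq_bigr => k _ do rewrite walksSr.
rewrite defect_period big_distrr /=.
transitivity (\sum_j edge_weight j l *
    (at_vertex n j (z - disp_of j)%R * Delta n (z - disp_of j)%R))%N.
  apply: eq_bigr => j _.
  by rewrite [RHS]mulnA -at_vertex_step; ring.
under eq_bigr => j _ do rewrite IH big_distrr /=.
rewrite exchange_big; apply: eq_bigr => x _ /=.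
under eq_bigr => j _ do rewrite big_distrr /=.
rewrite exchange_big; apply: eq_bigr => k _ /=.
rewrite big_distrr; apply: eq_bigr => j _ /=.
by rewrite [(z - x - _)%R]addrAC; ring.
Qed.

Lemma walks_le_defect n b l x z : D0 x <> 0%N -> init b = (x %% sigma%:Z)%Z ->
  (walks edge_weight edge_disps n b l (z - x)%R <= Delta n z)%N.
Proof.
move=> x0 bx; have [S0 S0E] : exists S : seq int, [set x | D0 x <> 0%N] = [set` S].
  exact/finite_seqP.
have supS y : D0 y <> 0%N -> y \in undup S0.
  by rewrite mem_undup; have /= <- := congr1 (fun X : set int => X y) S0E.
have W := defect_walks (undup S0) n l z (undup_uniq _) supS.
apply: (@leq_trans (at_vertex n l z * Delta n z)); last first.
  by rewrite -[leqRHS]mul1n leq_mul2r leq_b1 orbT.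
rewrite W (bigD1_seq x) ?supS ?undup_uniq //= (bigD1 b) //=.
rewrite /at_vertex mul0n subr0 bx eqxx muln1 -addnA.
apply: leq_trans (leq_addr _ _).
by rewrite -[leqLHS]mul1n leq_mul2r orbC lt0n; move/eqP: x0 => ->.
Qed.

(** The vertex under [z] may have no outgoing edge, so the last period is split off by
    [defect_period]; its edge and the initial site shift the displacement by at most [B]. By
    pigeonhole one walk weight in the resulting sum dominates up to a constant. *)
Lemma defect_le_walks : exists C B : nat, (0 < C)%N /\ forall n z,
  (0 < Delta n.+1 z)%N ->
  exists b l x, [/\ exists2 y : int, D0 y <> 0%N & init b = (y %% sigma%:Z)%Z,
    (`|x - z| <= B)%N &
    (Delta n.+1 z <= C * walks edge_weight edge_disps n b l x)%N].
Proof.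
have [S0 S0E] : exists S : seq int, [set x | D0 x <> 0%N] = [set` S].
  exact/finite_seqP.
set S := undup S0; have uS : uniq S by exact: undup_uniq.
have supS y : D0 y <> 0%N -> y \in S.
  by rewrite mem_undup; have /= <- := congr1 (fun X : set int => X y) S0E.
pose coef x (l k : 'I_d) : nat := (size_of l * (D0 x * at_vertex 0 k x))%N.
pose C := (\sum_l \sum_(x <- S) \sum_k coef x l k)%N.
pose B := (\sum_(x <- S) `|x| + \sum_l `|disp_of l|)%N.
exists C.+1, B; split => // n z pos.
pose W x l k := walks edge_weight edge_disps n k l (z - disp_of l - x).
have E : Delta n.+1 z = (\sum_l \sum_(x <- S) \sum_k coef x l k * W x l k)%N.
  rewrite defect_period; apply: eq_bigr => l _.
  rewrite (defect_walks S n l _ uS supS) big_distrl; apply: eq_bigr => x _ /=.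
  rewrite big_distrl; apply: eq_bigr => k _ /=.
  by rewrite /coef /W; ring.
apply: contrapT => no.
have small x l k : x \in S ->
    (coef x l k * (C.+1 * W x l k) <= coef x l k * (Delta n.+1 z).-1)%N.
  move=> xS; have [->//|c0] := posnP (coef x l k).
  rewrite leq_pmul2l // -ltnS prednK // ltnNge; apply/negP => big; apply: no.
  exists k, l, (z - disp_of l - x); split => //.
    move: c0; rewrite /coef !muln_gt0 => /and3P[_ Dx atk]; exists x.
      by move=> D0x; rewrite D0x in Dx.
    by move: atk; rewrite /at_vertex mul0n subr0 lt0b => /eqP.
  have xB : (`|x| <= \sum_(x <- S) `|x|)%N.
    by rewrite (bigD1_seq x) //= leq_addr.
  have lB : (`|disp_of l| <= \sum_l `|disp_of l|)%N.
    by rewrite (bigD1 l) //= leq_addr.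
  rewrite /B; lia.
have : (C.+1 * Delta n.+1 z <= C * (Delta n.+1 z).-1)%N.
  rewrite {1}E big_distrr /C big_distrl; apply: leq_sum => l _ /=.
  rewrite big_distrr big_distrl big_seq [leqRHS]big_seq; apply: leq_sum => x xS /=.
  rewrite big_distrr big_distrl; apply: leq_sum => k _ /=.
  by rewrite mulnCA; exact: small.
move: pos; case: (Delta n.+1 z) => // m _ /=; rewrite mulSn mulnS; lia.
Qed.

End defect_walks.

(** * Growth rates *)

Section extended_reals.
Context {R : realType}.
Local Open Scope ereal_scope.

Lemma lee_ltrP (x y : \bar R) : (forall r : R, r%:E < x -> r%:E <= y) -> x <= y.
Proof.
move=> H; rewrite leNgt; apply/negP; case: y H => [y| |] H; case: x H => [x| |] H //.
- rewrite lte_fin => yx; have := H ((x + y) / 2)%R; rewrite lte_fin lee_fin; lra.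
- by move=> _; have := H (y + 1)%R (ltry _); rewrite lee_fin; lra.
- by move=> _; have := H (x - 1)%R; rewrite lte_fin leeNy_eq /= => /(_ ltac:(lra)).
- by move=> _; have := H 0%R (ltry _); rewrite leeNy_eq.
Qed.

Lemma lee_gtrP (x y : \bar R) : (forall r : R, x < r%:E -> y <= r%:E) -> y <= x.
Proof.
move=> H; rewrite -leeN2; apply: lee_ltrP => r rx; rewrite -[r%:E]oppeK leeN2.
by rewrite -EFinN; apply: H; rewrite EFinN lteNr.
Qed.

Lemma limn_esup_le (u : nat -> \bar R) (a : \bar R) N :
  (forall n, (N <= n)%N -> u n <= a) -> limn_esup u <= a.
Proof.
move=> H; rewrite limn_esup_lim; apply: lime_le; first exact: is_cvg_esups.
exists N => // m Nm; apply: ge_ereal_sup => _ [p /= mp <-].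
by apply: H; exact: leq_trans mp.
Qed.

Lemma limn_einf_ge (u : nat -> \bar R) (a : \bar R) N :
  (forall n, (N <= n)%N -> a <= u n) -> a <= limn_einf u.
Proof.
move=> H; rewrite limn_einf_lim; apply: lime_ge; first exact: is_cvg_einfs.
exists N => // m Nm; apply: le_ereal_inf_tmp => _ [p /= mp <-].
by apply: H; exact: leq_trans mp.
Qed.

Lemma le_limn_esup (u v : nat -> \bar R) :
  (forall n, u n <= v n) -> limn_esup u <= limn_esup v.
Proof.
move=> uv; rewrite !limn_esup_lim; apply: lee_lim; try exact: is_cvg_esups.
apply: nearW => m; apply: ge_ereal_sup => _ [p /= mp <-].
by apply: le_trans (uv p) _; apply: ereal_sup_ubound; exists p.
Qed.

Lemma le_limn_einf (u v : nat -> \bar R) :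
  (forall n, u n <= v n) -> limn_einf u <= limn_einf v.
Proof. by move=> uv; rewrite leeN2; apply: le_limn_esup => n; rewrite leeN2. Qed.

Lemma lim_at_right0 (f : R -> \bar R) (s : \bar R) :
  (forall x y, (0 < x)%R -> (x <= y)%R -> f x <= f y) ->
  (forall x, (0 < x)%R -> s <= f x) ->
  (forall r : R, s < r%:E -> exists2 x, (0 < x)%R & f x <= r%:E) ->
  lim (f x @[x --> 0^'+]) = s.
Proof.
move=> fmono lb ub; apply: cvg_lim => //.
have -> : s = ereal_inf (f @` [set` Interval (BRight 0%R) (BLeft 1%R)]).
  apply/eqP; rewrite eq_le; apply/andP; split.
    by apply: le_ereal_inf_tmp => _ [x + <-]; rewrite /= in_itv => /andP[x0 _]; exact: lb.
  apply: lee_gtrP => r /ub[x x0 xr].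
  apply: le_trans xr; have [x1|x1] := ltP x 1%R.
    by apply: ereal_inf_lbound; exists x => //=; rewrite in_itv /= x0.
  apply: (@le_trans _ _ (f 2^-1)%R); last by apply: fmono => //; lra.
  by apply: ereal_inf_lbound; exists 2^-1%R => //=; rewrite in_itv /=; apply/andP; split; lra.
apply: nondecreasing_at_right_cvge; first by rewrite bnd_simp.
by move=> x y; rewrite in_itv /= => /andP[x0 _] _ xy; exact: fmono.
Qed.

End extended_reals.

(** * Counting defects in a window *)

Section defect_counting.
Context {R : realType} (A : binary_ca) (xi0 : config) (D0 : int -> nat).
Context (fin0 : finite_set [set x | D0 x <> 0%N]).
Implicit Types (alpha eps : R) (t : nat) (x : int).
Local Notation Delta t x := (defect A xi0 D0 t x).

Definition int_range (N : nat) : seq int := [seq i%:Z - N%:Z | i <- iota 0 (N + N).+1].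

Lemma int_range_uniq N : uniq (int_range N).
Proof. by rewrite map_inj_uniq ?iota_uniq // => i j /addIr []. Qed.

Lemma mem_int_range N x : (`|x| <= N)%N -> x \in int_range N.
Proof.
move=> xN; apply/mapP; exists `|(x + N%:Z)%R|%N; last by lia.
by rewrite mem_iota; lia.
Qed.

Lemma defect_support : exists B : nat, forall t x,
  Delta t x <> 0%N -> (`|x| <= B + ca_radius A * t)%N.
Proof.
have [S0 S0E] : exists S : seq int, [set x | D0 x <> 0%N] = [set` S].
  exact/finite_seqP.
exists (\sum_(x <- undup S0) `|x|)%N => t x tx.
have [y [yx xy]] := defect_steps A xi0 D0 0 t x; rewrite add0n /= in xy.
have y0 : D0 y <> 0%N by move=> y0; apply: tx; move: xy; rewrite y0 muln0; lia.
have yS : y \in undup S0.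
  by rewrite mem_undup; have /= <- := congr1 (fun X : set int => X y) S0E.
have : (`|y| <= \sum_(x <- undup S0) `|x|)%N.
  by rewrite (bigD1_seq y) ?undup_uniq //= leq_addr.
lia.
Qed.

Lemma defect_countE alpha eps t N : (forall x, Delta t x <> 0%N -> (`|x| <= N)%N) ->
  defect_count A xi0 D0 alpha eps t =
  \sum_(x <- int_range N | `|x%:~R / t%:R - alpha| < eps) (Delta t x)%:R.
Proof.
move=> tN; rewrite /defect_count.
rewrite (bigfs _ (int_range_uniq N)) // => x _ xN; apply/eqP.
rewrite pnatr_eq0; apply: contraNT xN => /eqP/tN; exact: mem_int_range.
Qed.

Lemma defect_count_ge alpha eps t x : `|x%:~R / t%:R - alpha| < eps ->
  (Delta t x)%:R <= defect_count A xi0 D0 alpha eps t.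
Proof.
move=> xe; have [B HB] := defect_support.
have [->|nz] := eqVneq (Delta t x) 0%N.
  by rewrite (defect_countE _ _ _ _ (HB t)) sumr_ge0.
rewrite (defect_countE _ _ _ _ (HB t)) big_mkcond (bigD1_seq x) ?int_range_uniq //=.
- by rewrite xe lerDl sumr_ge0 // => y _; case: ifP.
- by apply/mem_int_range/HB/eqP.
Qed.

(** Defects occupy at most linearly many sites in [t], so the largest value in the window controls
    the count up to a factor without effect on exponential rates. *)
Lemma defect_count_le : exists B : nat, forall alpha eps t,
  0 < defect_count A xi0 D0 alpha eps t ->
  exists x, [/\ `|x%:~R / t%:R - alpha| < eps, (0 < Delta t x)%N &
    defect_count A xi0 D0 alpha eps t <= (B * t.+1 * Delta t x)%:R].
Proof.
have [B HB] := defect_support.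
(* Times [t.+1], this bounds the number 2N + 1 of sites of [int_range N] for [N] as below. *)
exists (2 * (B + ca_radius A) + 1)%N => alpha eps t.
set N := (B + ca_radius A * t)%N; rewrite (defect_countE _ _ _ N) //; last exact: HB.
set P := fun x : int => `|x%:~R / t%:R - alpha| < eps => pos.
have [x0 [Px0 x0N]] : exists x, P x /\ (0 < Delta t x)%N.
  apply: contrapT => no; move: pos; rewrite big1 ?ltxx // => x Px; apply/eqP.
  rewrite pnatr_eq0 -leqn0 leqNgt; apply/negP => x0; apply: no; by exists x.
pose I := seq_sub (int_range N).
have x0S : x0 \in int_range N by apply/mem_int_range/HB; lia.
pose i0 : I := SeqSub x0S.
case: (@arg_maxnP _ i0 (fun i : I => P (ssval i)) (fun i => Delta t (ssval i)) Px0) => i Pi imax.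
exists (ssval i); split => //; first exact: leq_trans x0N (imax i0 Px0).
apply: (@le_trans _ _ (\sum_(x <- int_range N) (Delta t (ssval i))%:R)).
  rewrite big_mkcond big_seq [leRHS]big_seq; apply: ler_sum => x xS.
  case: ifP => [Px|_]; last exact: ler0n.
  by rewrite ler_nat; exact: (imax (SeqSub xS) Px).
rewrite big_const_seq count_predT size_map size_iota iter_addr addr0.
rewrite -[leLHS]mulr_natl -natrM ler_nat leq_mul2r; apply/orP; right.
by rewrite /N; nia.
Qed.

Lemma growth_rate_le alpha eps t (r : R) : (0 < t)%N ->
  defect_count A xi0 D0 alpha eps t <= expR (t%:R * r) ->
  (growth_rate A xi0 D0 alpha eps t <= r%:E)%E.
Proof.
move=> t0 ct; have t0R : 0 < t%:R :> R by rewrite ltr0n.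
rewrite /growth_rate; have [c0|c0] := leP (defect_count A xi0 D0 alpha eps t) 0.
  rewrite le0_lneNy ?lee_fin // mulrNy gtr0_sg ?invr_gt0 // mul1e leNye //.
rewrite lne_EFin // -EFinM lee_fin ler_pdivrMl // -[leRHS]expRK ler_ln ?posrE ?expR_gt0 //.
Qed.

Lemma growth_rate_ge alpha eps t (r : R) : (0 < t)%N ->
  expR (t%:R * r) <= defect_count A xi0 D0 alpha eps t ->
  (r%:E <= growth_rate A xi0 D0 alpha eps t)%E.
Proof.
move=> t0 ct; have t0R : 0 < t%:R :> R by rewrite ltr0n.
have c0 : 0 < defect_count A xi0 D0 alpha eps t by apply: lt_le_trans ct; exact: expR_gt0.
rewrite /growth_rate lne_EFin // -EFinM lee_fin ler_pdivlMl //.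
by rewrite -[leLHS]expRK ler_ln ?posrE ?expR_gt0.
Qed.

Lemma le_growth_rate alpha eps eps' t : eps <= eps' ->
  (growth_rate A xi0 D0 alpha eps t <= growth_rate A xi0 D0 alpha eps' t)%E.
Proof.
move=> ee; have [B HB] := defect_support.
rewrite /growth_rate; apply: lee_wpmul2l; first by rewrite lee_fin invr_ge0.
have c0 eps'' : 0 <= defect_count A xi0 D0 alpha eps'' t.
  by rewrite (defect_countE _ _ _ _ (HB t)) sumr_ge0.
rewrite lee_lne ?in_itv /= ?leey ?andbT ?lee_fin //.
rewrite !(defect_countE _ _ _ _ (HB t)) big_mkcond [leRHS]big_mkcond /=.
apply: ler_sum => x _; case: ifP => [xe|_]; last by case: ifP.
by rewrite (lt_le_trans xe ee).
Qed.

End defect_counting.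

(** * Exponential bounds on the windowed counts *)

Section growth_bounds.
Context {R : realType} (A : binary_ca) (eta : config) (sigma pi0 sigma0 : nat).
Context (sigma_gt0 : (0 < sigma)%N) (pi0_gt0 : (0 < pi0)%N)
  (eta_mod : forall x : int, eta x = eta (x %% sigma%:Z)%Z)
  (eta_shift : forall x : int, iter pi0 (global_map A) eta x = eta (x - sigma0%:Z)).
Context (D0 : int -> nat) (fin0 : finite_set [set x | D0 x <> 0%N]).
Context (d : nat) (e : d.-tuple (edge sigma)) (He : edge_ordering A eta pi0 e).
Local Notation tn := (edge_weight A eta sigma pi0 sigma0 d e).
Local Notation dv := (edge_disps sigma d e).
Local Notation p := (pi0%:R : R).
Local Notation count := (defect_count A eta D0).
Local Notation growth := (growth_rate A eta D0).

Let p_gt0 : 0 < p. Proof. by rewrite ltr0n. Qed.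

Lemma absz_le_norm (x : int) (n : nat) : (`|x| <= n)%N -> `|x%:~R| <= n%:R :> R.
Proof. by move=> xn; rewrite -intr_norm -abszE -pmulrn ler_nat. Qed.

Lemma walks_upper_uniform (a rho r' : R) :
  (forall b, initial_edges e D0 b ->
     forall nu, reachable_flow tn dv b a nu -> flow_rate tn nu <= rho) ->
  rho < r' ->
  exists (N : nat) (delta : R), 0 < delta /\
    forall b n l x, initial_edges e D0 b -> (N <= n)%N ->
    `|x%:~R / n%:R - a| <= delta ->
    (walks tn dv n b l x)%:R <= (n.+1 ^ (d * d))%:R * expR (n%:R * r') :> R.
Proof.
move=> H rr'.
have /choice[Nd HNd] : forall b, exists Nd : nat * R, 0 < Nd.2 /\
    (initial_edges e D0 b -> forall n l x, (Nd.1 <= n)%N ->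
    `|x%:~R / n%:R - a| <= Nd.2 ->
    (walks tn dv n b l x)%:R <= (n.+1 ^ (d * d))%:R * expR (n%:R * r') :> R).
  move=> b; have [bi|nbi] := pselect (initial_edges e D0 b).
    have [N [dl [dl0 HN]]] := walks_upper tn dv b a rho r' (H b bi) rr'.
    by exists (N, dl).
  by exists (0%N, 1); split => //=; exact: ltr01.
(* This radius lies below every [(Nd b).2] and is positive even if there are no edges. *)
exists (\sum_b (Nd b).1)%N, (1 + \sum_b (Nd b).2^-1)^-1; split.
  rewrite invr_gt0 ltr_wpDr // sumr_ge0 // => b _.
  by rewrite invr_ge0 ltW //; case: (HNd b).
move=> b n l x bi Nn xa; have [d0] := HNd b; apply => //.
  by apply: leq_trans Nn; rewrite (bigD1 b) //= leq_addr.
apply: le_trans xa _; rewrite -[leRHS]invrK lef_pV2 ?posrE ?invr_gt0 //; last first.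
  rewrite ltr_wpDr // sumr_ge0 // => b' _.
  by rewrite invr_ge0 ltW //; case: (HNd b').
rewrite (bigD1 b) //= addrCA lerDl addr_ge0 // sumr_ge0 // => b' _.
by rewrite invr_ge0 ltW //; case: (HNd b').
Qed.

(** Up to a polynomial factor the count is bounded by a single walk weight. One step lasts [pi0]
    time units, so velocity [alpha] becomes mean displacement [p * alpha]; the gap between [rho] and
    [p * r] pays for all subexponential factors. *)
Lemma growth_upper (alpha rho r : R) :
  (forall b, initial_edges e D0 b ->
     forall nu, reachable_flow tn dv b (p * alpha) nu -> flow_rate tn nu <= rho) ->
  rho < p * r ->
  exists2 eps, 0 < eps & exists N : nat, forall t, (N <= t)%N ->
    (growth alpha eps t <= r%:E)%E.
Proof.
move=> H rr; pose r' := (rho + p * r) / 2.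
have rr' : rho < r' by rewrite /r'; lra.
have r'r : r' < p * r by rewrite /r'; lra.
have [N0 [dl [dl0 HN0]]] := walks_upper_uniform _ _ _ H rr'.
have [B count_le] := defect_count_le (R := R) A eta D0 fin0.
have [C [B' [C0 HC]]] := defect_le_walks A eta sigma pi0 sigma0 sigma_gt0
  eta_mod eta_shift D0 fin0 d e He.
pose K := (ca_branching A ^ pi0)%N.
pose M := (B * (2 * pi0) * K * C)%N.
(* The power [(d * d).+1] of [n.+1] stems from the types of walks and the number of sites. By the
   choice of [th] it costs half of the gap [n * (p * r - r')]; [N2] fits the constants into the
   other half. *)
pose th := (p * r - r') / (2 * (d * d).+1%:R).
have th0 : 0 < th by rewrite divr_gt0 ?subr_gt0 // mulr_gt0.
have [N1 HN1] := natS_le_expR (R := R) _ th0.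
have [N2 HN2] := archi_gt (R := R) (2 * (M%:R + 2 * p * `|r|) / (p * r - r')).
have [N3 HN3] := archi_gt (R := R)
  (2 * (B'%:R + (ca_radius A)%:R * p + dl + 2 * p * `|alpha|) / dl).
(* Per edge this window is about [dl / 2]; [N3] keeps the bounded displacements within the remaining
   [dl / 2]. *)
exists (dl / (2 * p)); first by rewrite divr_gt0 // mulr_gt0.
exists ((N0 + N1 + N2 + N3 + 2) * pi0)%N => t tN.
(* The quotient is written [n.+1] because [defect_le_walks] spends one period on the last edge. *)
have [n [g [tE gp nN]]] : exists n g, [/\ t = (n.+1 * pi0 + g)%N, (g < pi0)%N &
    (N0 + N1 + N2 + N3 < n)%N].
  exists (t %/ pi0).-1, (t %% pi0)%N.
  have tp : (N0 + N1 + N2 + N3 + 2 <= t %/ pi0)%N by rewrite leq_divRL.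
  have tp1 : (0 < t %/ pi0)%N by clear -tp; lia.
  by split; [rewrite prednK // -divn_eq|rewrite ltn_pmod|clear -tp; lia].
have N0n : (N0 <= n)%N by clear -nN; lia.
have {}HN1 := HN1 n ltac:(clear -nN; lia); have {}HN2 := HN2 n ltac:(clear -nN; lia).
have {}HN3 := HN3 n ltac:(clear -nN; lia).
have n0 : 0 < n%:R :> R by rewrite ltr0n; clear -nN; lia.
have t0 : (0 < t)%N by rewrite tE addn_gt0 muln_gt0 pi0_gt0.
have t0R : 0 < t%:R :> R by rewrite ltr0n.
have tR1 : n%:R * p <= t%:R.
  by rewrite -natrM ler_nat tE mulSn; clear; lia.
have tR2 : t%:R <= n%:R * p + 2 * p.
  by rewrite -!natrM -natrD ler_nat tE mulSn; clear -gp; lia.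
apply: growth_rate_le => //.
have [c0|c0] := leP (count alpha (dl / (2 * p)) t) 0.
  by apply: le_trans c0 (expR_ge0 _).
have [x [xw xD xc]] := count_le _ _ _ c0.
have [y [yx xy]] := defect_steps A eta D0 (n.+1 * pi0) g x.
rewrite -tE in xy.
have yD : (0 < defect A eta D0 (n.+1 * pi0) y)%N.
  by rewrite lt0n; apply: contraTneq xy => ->; rewrite muln0 -ltnNge.
have [b [l [z [[x0 x0D bx0] zy yz]]]] := HC _ _ yD.
have bi : initial_edges e D0 b by exists x0.
have zd : `|z%:~R / n%:R - p * alpha| <= dl.
  have xw' : `|x%:~R - alpha * t%:R| <= dl / (2 * p) * t%:R.
    have -> : x%:~R - alpha * t%:R = (x%:~R / t%:R - alpha) * t%:R.
      by rewrite mulrBl divfK // gt_eqF.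
    by rewrite normrM (gtr0_norm t0R) ler_wpM2r // ltW.
  have dt : dl / (2 * p) * t%:R <= dl / 2 * n%:R + dl.
    have -> : dl / 2 * n%:R + dl = dl / (2 * p) * (n%:R * p + 2 * p).
      by field; rewrite gt_eqF.
    by rewrite ler_wpM2l // divr_ge0 ?ltW // mulr_gt0.
  have st : `|alpha * (t%:R - n%:R * p)| <= 2 * p * `|alpha|.
    rewrite normrM mulrC ler_wpM2r // ger0_norm ?subr_ge0 //; lra.
  have yx' : `|(y - x)%:~R| <= (ca_radius A)%:R * p :> R.
    apply: le_trans (absz_le_norm _ _ yx) _.
    by rewrite natrM ler_wpM2l // ler_nat ltnW.
  have zy' := absz_le_norm _ _ zy.
  rewrite ltr_pdivrMr // in HN3.
  have -> : z%:~R / n%:R - p * alpha = (z%:~R - n%:R * (p * alpha)) / n%:R.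
    by field; rewrite gt_eqF.
  rewrite normrM normfV (gtr0_norm n0) ler_pdivrMr //.
  rewrite !rmorphB /= in zy' yx'.
  move: zy' yx' st xw'; rewrite !ler_norml => /andP[? ?] /andP[? ?] /andP[? ?] /andP[? ?].
  apply/andP; split; lra.
have W := HN0 b n l z bi N0n zd.
have W0 : (0 < walks tn dv n b l z)%N.
  by rewrite lt0n; apply: contraTneq yz => ->; rewrite muln0 -ltnNge.
have cM : count alpha (dl / (2 * p)) t <= (M * n.+1 * walks tn dv n b l z)%:R.
  apply: le_trans xc _; rewrite ler_nat /M.
  have tS : (t.+1 <= 2 * pi0 * n.+1)%N.
    apply: (@leq_trans (n.+2 * pi0)).
      by rewrite tE mulSn addnC [X in (_ <= X)%N]mulSn mulSn; clear -gp; lia.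
    by rewrite mulnAC leq_mul2r; apply/orP; right; clear; lia.
  have xW : (defect A eta D0 t x <= K * (C * walks tn dv n b l z))%N.
    apply: leq_trans xy _; apply: leq_mul yz.
    by rewrite leq_pexp2l // ltnW.
  apply: leq_trans (leq_mul (leq_mul (leqnn B) tS) xW) _.
  by apply/eq_leq; ring.
apply: le_trans cM _; rewrite natrM.
apply: le_trans (ler_wpM2l (ler0n _ _) W) _.
have dd0 : 0 < (d * d).+1%:R :> R by rewrite ltr0n.
have pw : (n.+1 ^ (d * d).+1)%:R <= expR (n%:R * ((p * r - r') / 2)) :> R.
  rewrite natrX; apply: le_trans (lerXn2r _ _ _ HN1) _; rewrite ?nnegrE ?expR_ge0 ?ler0n //.
  rewrite -expRM_natl ler_expR le_eqVlt; apply/orP; left; apply/eqP.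
  by rewrite /th; field; rewrite gt_eqF.
rewrite [X in X * _ <= _]natrM mulrA -[X in X * expR _]mulrA -natrM -expnS.
have ME : M%:R <= expR M%:R :> R.
  by apply: le_trans (expR_ge1Dx _); rewrite lerDr.
apply: (@le_trans _ _ (expR M%:R * expR (n%:R * ((p * r - r') / 2)) * expR (n%:R * r'))).
  by rewrite ler_wpM2r ?expR_ge0 // ler_pM.
rewrite -!expRD ler_expR.
rewrite ltr_pdivrMr ?subr_gt0 // in HN2.
have : `|(t%:R - n%:R * p) * r| <= 2 * p * `|r|.
  by rewrite normrM ler_wpM2r // ger0_norm ?subr_ge0 //; lra.
rewrite ler_norml => /andP[? ?]; lra.
Qed.

(** [t] is rounded up to the end of a walk of [walks_lower], at most [G] time steps later, and the
    defects found there are traced back to a site [w] at time [t]. *)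
Lemma growth_lower (alpha r : R) (b : 'I_d) (mu : 'I_d -> R) (q : 'I_d -> 'I_d -> R) :
  initial_edges e D0 b ->
  (forall i, 0 <= mu i) -> \sum_i mu i = 1 ->
  (forall i j, 0 <= q i j) -> (forall i, \sum_j q i j = 1) ->
  (forall l, \sum_k mu k * q k l = mu l) ->
  (forall i j, 0 < mu i * q i j -> (0 < tn i j)%N) ->
  (forall i, 0 < mu i -> reach tn dv b i) ->
  (forall i j, 0 < mu i -> 0 < mu j -> reach tn dv i j \/ reach tn dv j i) ->
  mean_disp dv mu = p * alpha -> p * r < chain_rate tn mu q ->
  forall eps, 0 < eps -> exists N : nat, forall t, (N <= t)%N ->
    (r%:E <= growth alpha eps t)%E.
Proof.
move=> [x0 x0D bx0] mu0 mu1 q0 q1 inv qT breach chain mean rH eps eps0.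
pose h := (p * r + chain_rate tn mu q) / 2.
have rh : p * r < h by rewrite /h; lra.
have hH : h < chain_rate tn mu q by rewrite /h; lra.
(* An edge lasts [p] time units, so an error of [p * eps / 2] per edge uses half of the window; [N2]
   leaves the other half to the bounded displacements. *)
have e0 : 0 < p * eps / 2 by rewrite divr_gt0 ?mulr_gt0.
have [L [c [y [Y [Om [l [L0 YL OmL HW]]]]]]] := walks_lower tn dv mu q mu0 mu1 q0 q1
  inv qT b h (p * eps / 2) hH e0 breach chain.
rewrite mean in YL.
pose G := (c * pi0 + L * pi0)%N; pose K := (ca_branching A ^ G)%N.
have L0R : 0 < L%:R :> R by rewrite ltr0n.
have [N1 HN1] := archi_gt (R := R)
  (p * (ln K%:R + L%:R * p * `|r|) / (h - p * r)).
have [N2 HN2] := archi_gt (R := R) (2 * ((ca_radius A)%:R * G%:R + `|x0%:~R| + `|y%:~R|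
  + `|alpha| * (L%:R * p) + p * eps / 2 * L%:R) / eps).
exists (N1 + N2 + 1)%N => t tN.
have t0 : (0 < t)%N by clear -tN; lia.
have t0R : 0 < t%:R :> R by rewrite ltr0n.
pose j := (t %/ (L * pi0)).+1.
have LP : (0 < L * pi0)%N by rewrite muln_gt0 L0.
have /andP[jt1 jt2] : (t <= j * (L * pi0) <= t + L * pi0)%N.
  by rewrite ltnW ?ltn_ceil //= mulSn addnC leq_add2r leq_divM.
pose z := x0 + (y + Y *+ j).
pose g := ((c + j * L) * pi0 - t)%N.
have gE : (t + g)%N = ((c + j * L) * pi0)%N 
  by rewrite subnKC // mulnDl -mulnA; apply: leq_trans (leq_addl _ _).
have gG : (g <= G)%N 
  by rewrite leq_subLR mulnDl -mulnA /G [leqRHS]addnCA leq_add2l.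
have [w [wz wK]] := defect_steps A eta D0 t g z.
have zW : expR (j%:R * Om) <= K%:R * (defect A eta D0 t w)%:R.
  apply: le_trans (HW j) _; rewrite -natrM ler_nat.
  have := walks_le_defect A eta sigma pi0 sigma0 sigma_gt0 eta_mod eta_shift D0 fin0
    d e He (c + j * L) b l x0 z x0D bx0.
  have -> : z - x0 = y + Y *+ j by rewrite /z addrAC subrr add0r.
  rewrite -gE => /leq_trans; apply; apply: leq_trans wK _.
  by rewrite leq_mul2r /K leq_pexp2l ?orbT.
have K0 : 0 < K%:R :> R by rewrite ltr0n expn_gt0.
have jtR1 : t%:R <= j%:R * (L%:R * p) by rewrite -!natrM ler_nat.
have jtR2 : j%:R * (L%:R * p) <= t%:R + L%:R * p.
  by rewrite -!natrM -natrD ler_nat.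
apply: growth_rate_ge => //.
apply: (@le_trans _ _ (defect A eta D0 t w)%:R); last first.
  apply: defect_count_ge => //.
  have -> : w%:~R / t%:R - alpha = (w%:~R - alpha * t%:R) / t%:R.
    by field; rewrite gt_eqF.
  rewrite normrM normfV (gtr0_norm t0R) ltr_pdivrMr //.
  have {}HN2 := HN2 t ltac:(clear -tN; lia); rewrite ltr_pdivrMr // in HN2.
  have wz' : `|(w - z)%:~R| <= (ca_radius A)%:R * G%:R :> R.
    apply: le_trans (absz_le_norm _ _ wz) _.
    by rewrite natrM ler_wpM2l // ler_nat.
  have wE : w%:~R = (w - z)%:~R + (x0%:~R + (y%:~R + Y%:~R * j%:R)) :> R.
    rewrite -[LHS](subrK (z%:~R)) -rmorphB /= /z !rmorphD /= rmorphMn /=.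
    by rewrite mulr_natr.
  have jY : `|j%:R * (Y%:~R - p * alpha * L%:R)| <= eps / 2 * (t%:R + L%:R * p).
    rewrite normrM ger0_norm //; apply: le_trans (ler_wpM2l (ler0n _ _) YL) _.
    have -> : j%:R * (p * eps / 2 * L%:R) = eps / 2 * (j%:R * (L%:R * p)) by ring.
    by rewrite ler_wpM2l // divr_ge0 // ltW.
  have at_ : `|alpha * (j%:R * (L%:R * p) - t%:R)| <= `|alpha| * (L%:R * p).
    by rewrite normrM ler_wpM2l // ger0_norm ?subr_ge0 //; lra.
  rewrite {}wE ltr_norml; move: wz' jY at_; rewrite !ler_norml.
  move=> /andP[? ?] /andP[? ?] /andP[? ?].
  have : - `|x0%:~R : R| <= x0%:~R <= `|x0%:~R : R| by rewrite -ler_norml.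
  have : - `|y%:~R : R| <= y%:~R <= `|y%:~R : R| by rewrite -ler_norml.
  by move=> /andP[? ?] /andP[? ?]; apply/andP; split; lra.
apply: (@le_trans _ _ (expR (j%:R * Om - ln K%:R))); last first.
  by rewrite expRB lnK ?posrE // ler_pdivrMr // [leRHS]mulrC.
rewrite ler_expR.
have {}HN1 := HN1 t ltac:(clear -tN; lia); rewrite ltr_pdivrMr ?subr_gt0 // in HN1.
have jOm : j%:R * (h * L%:R) <= j%:R * Om by rewrite ler_wpM2l.
have tr : `|(j%:R * (L%:R * p) - t%:R) * r| <= L%:R * p * `|r|.
  by rewrite normrM ler_wpM2r // ger0_norm ?subr_ge0 //; lra.
have hr0 : 0 <= h - p * r by rewrite subr_ge0 ltW.
have := lt_le_trans HN1 (ler_wpM2r hr0 jtR1).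
have -> : j%:R * (L%:R * p) * (h - p * r) = p * (j%:R * L%:R * (h - p * r)) by ring.
rewrite ltr_pM2l // => E.
move: tr; rewrite ler_norml => /andP[? ?]; lra.
Qed.

End growth_bounds.

(** * From flows to measures and kernels, and the variational formula *)

Section assembly.
Context {R : realType} (A : binary_ca) (eta : config) (sigma pi0 sigma0 : nat).
Context (d : nat) (e : d.-tuple (edge sigma)).
Local Notation tn := (edge_weight A eta sigma pi0 sigma0 d e).
Local Notation dv := (edge_disps sigma d e).
Local Notation TM := (expansion_matrix A eta pi0 sigma0 e : 'M[R]_d).

Lemma expansion_matrixE k l : TM k l = (tn k l)%:R.
Proof. by rewrite mxE /edge_weight; case: ifP. Qed.

Lemma expansion_matrix_pow n k l :
  0 <= (TM ^+ n) k l /\ (0 < (TM ^+ n) k l <-> exists x, (0 < walks tn dv n k l x)%N).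
Proof.
elim: n k => [|n IH] k.
  rewrite expr0 mxE; split; first exact: ler0n.
  rewrite ltr0n lt0b; split=> [/eqP ->|[x] /=]; first by exists 0; rewrite /= !eqxx.
  by rewrite lt0b => /andP[].
have E : (TM ^+ n.+1) k l = \sum_j (tn k j)%:R * (TM ^+ n) j l.
  by rewrite exprS mxE; apply: eq_bigr => j _; rewrite expansion_matrixE.
have T0 j : 0 <= (tn k j)%:R * (TM ^+ n) j l.
  by rewrite mulr_ge0 //; case: (IH j).
split; first by rewrite E sumr_ge0.
rewrite E; split=> [|[x]].
  rewrite lt_def sumr_ge0 ?andbT // psumr_eq0 // => /allPn[j _].
  rewrite /= mulf_eq0 negb_or => /andP[]; rewrite pnatr_eq0 -lt0n => kj nz.
  have [j0 [+ _]] := IH j; rewrite lt_def nz j0 => /(_ isT)[x jx].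
  exists (dv k + x); rewrite /= (bigD1 j) //= addn_gt0 muln_gt0 kj.
  by rewrite [dv k + x]addrC addrK jx.
rewrite /= lt0n sum_nat_eq0 negb_forall => /existsP[j] /=.
rewrite -lt0n muln_gt0 => /andP[kj jx]; rewrite (bigD1 j) //= ltr_wpDr //.
  by rewrite sumr_ge0.
rewrite mulr_gt0 ?ltr0n //; have [_ [_]] := IH j; apply; by exists (x - dv k).
Qed.

Lemma leadstoE k l : leadsto (R := R) A eta pi0 sigma0 e k l <-> reach tn dv k l.
Proof.
split=> [[->|[n kl]]|[n [x kl]]].
- exact: reach_refl.
- by exists n; have [_ [+ _]] := expansion_matrix_pow n k l; apply.
- by right; exists n; have [_ [_]] := expansion_matrix_pow n k l; apply; exists x.
Qed.

Lemma entropy_rateE (q : 'M[R]_d) (mu : 'I_d -> R) :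
  (forall i, 0 <= mu i) -> (forall i j, 0 <= q i j) ->
  (forall i j, 0 < mu i * q i j -> (0 < tn i j)%N) ->
  entropy_rate A eta pi0 sigma0 e q mu = (chain_rate tn mu (fun i j => q i j))%:E.
Proof.
move=> mu0 q0 qT; rewrite /entropy_rate /chain_rate -sumEFin; apply: eq_bigr => i _.
rewrite -sumEFin; apply: eq_bigr => j _.
case: eqP => [->|/eqP nz]; first by rewrite mul0r.
have mq : 0 < mu i * q i j by rewrite lt_def nz mulr_ge0.
have q_gt0 : 0 < q i j.
  by rewrite lt_def q0 andbT; apply: contraTneq mq => ->; rewrite mulr0 ltxx.
have T0 : 0 < (tn i j)%:R :> R by rewrite ltr0n qT.
by rewrite expansion_matrixE lne_EFin ?divr_gt0 // ln_div ?posrE.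
Qed.

(** A transition of positive mass and weight 0 contributes [-oo], which absorbs the whole sum. *)
Lemma entropy_rate_support (q : 'M[R]_d) (mu : 'I_d -> R) (r : R) :
  (forall i, 0 <= mu i) -> (forall i j, 0 <= q i j) ->
  (r%:E < entropy_rate A eta pi0 sigma0 e q mu)%E ->
  forall i j, 0 < mu i * q i j -> (0 < tn i j)%N.
Proof.
move=> mu0 q0 rE i j ij; rewrite lt0n; apply/negP => /eqP T0.
suff H : entropy_rate A eta pi0 sigma0 e q mu = -oo%E by rewrite H ltNge leNye in rE.
apply/esum_eqNyP; exists i; split=> //.
apply/esum_eqNyP; exists j; split=> //.
rewrite gt_eqF // expansion_matrixE T0 mul0r le0_lneNy //.
by rewrite gt0_muleNy // lte_fin.
Qed.

(** Disintegration of [nu] into row sums and transition probabilities; rows without mass are taken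
    from the identity matrix to keep [q] stochastic. *)
Lemma flow_kernel (b : 'I_d) (a : R) (nu : 'I_d -> 'I_d -> R)
    (mu := fun i => \sum_j nu i j)
    (q := \matrix_(i, j) (if mu i == 0 then (i == j)%:R else nu i j / mu i)) :
  reachable_flow tn dv b a nu ->
  [/\ (prob_mean_disp e a `&` prob_chain A eta pi0 sigma0 e b) mu,
   invariant_kernels mu q &
   entropy_rate A eta pi0 sigma0 e q mu = (flow_rate tn nu)%:E].
Proof.
case=> nu0 nu1 bal dsp edges breach chain.
have mu0 i : 0 <= mu i by apply: sumr_ge0.
have muq i j : mu i * q i j = nu i j.
  rewrite mxE; case: eqP => [mi|/eqP mi]; last by rewrite mulrC divfK.
  rewrite mi mul0r; apply/esym/eqP.
  by have /eqP := mi; rewrite psumr_eq0 // => /allP /(_ j); rewrite mem_index_enum; apply.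
have q0 i j : 0 <= q i j by rewrite mxE; case: ifP => _; rewrite ?ler0n ?divr_ge0.
have pm : prob_measures mu by [].
split.
- split; first by split.
  split=> // [k nbk|k l nlk nkl].
    apply/eqP; apply: contrapT => /negP mk; apply: nbk; apply/leadstoE/breach.
    by rewrite lt_def mk mu0.
  apply/eqP; rewrite mulf_eq0; apply: contrapT => /negP; rewrite negb_or => /andP[mk ml].
  have [||kl|lk] := chain k l; try by [rewrite lt_def ?mk ?ml mu0].
    by apply: nkl; apply/leadstoE.
  by apply: nlk; apply/leadstoE.
- split=> // [k|l].
    under eq_bigr => l _ do rewrite mxE.
    case: eqP => [_|/eqP mk]; last by rewrite -big_distrl /= divff.
    by rewrite (bigD1 k) //= eqxx big1 ?addr0 // => l /negbTE; rewrite eq_sym => ->.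
  by under eq_bigr => k _ do rewrite muq; rewrite -bal.
rewrite entropy_rateE //; last by move=> i j; rewrite muq; exact: edges.
congr EFin; apply: eq_bigr => i _; apply: eq_bigr => j _; rewrite muq.
have [->|nz] := eqVneq (nu i j) 0; first by rewrite !mul0r.
suff -> : q i j = nu i j / mu i by [].
rewrite mxE; case: eqP => // mi; move: nz; rewrite -(muq i j) mi mul0r eqxx //.
Qed.

End assembly.

(** An edge spans [pi0] time steps. So velocity [alpha] is a mean displacement [pi0 * alpha] per
    edge, and the entropy per edge is divided by [pi0] to give a rate per time step; for [pi0 = 1]
    both factors disappear. *)
Theorem theorem6p3 (R : realType) (A : binary_ca) (eta : config)
    (p sigma pi0 sigma0 : nat)
    (Heta : doubly_periodic A eta p sigma pi0 sigma0)
    (D0 : int -> nat) (HD0 : defect_config D0)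
    (d : nat) (e : d.-tuple (edge sigma))
    (He : edge_ordering A eta pi0 e) :
  lyapunov_proper (R := R) A eta D0 /\
  forall alpha : R,
    lyapunov A eta D0 alpha =
      ((pi0%:R^-1)%:E *
       ereal_sup
         [set ereal_sup
            [set ereal_sup
               [set entropy_rate A eta pi0 sigma0 e q mu
                 | q in invariant_kernels mu]
              | mu in prob_mean_disp e (pi0%:R * alpha)
                      `&` prob_chain A eta pi0 sigma0 e b]
           | b in initial_edges e D0])%E.
Proof.
case: Heta => _ [[sg em] _] _ [p0 _ es]; case: HD0 => _ fin0.
have p0R : 0 < pi0%:R :> R by rewrite ltr0n.
set S : R -> \bar R := fun alpha => ereal_sup
  [set ereal_sup
    [set ereal_sup
      [set entropy_rate A eta pi0 sigma0 e q mu | q in invariant_kernels mu]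
    | mu in prob_mean_disp e (pi0%:R * alpha) `&` prob_chain A eta pi0 sigma0 e b]
  | b in initial_edges e D0].
(* This bounds the liminf in every window, and [upper] bounds the limsup in some window; together
   they determine both profiles. *)
have lower alpha eps : 0 < eps ->
    ((pi0%:R^-1)%:E * S alpha <= limn_einf (growth_rate (R := R) A eta D0 alpha eps))%E.
  move=> eps0; apply: lee_ltrP => r; rewrite lte_pdivlMl //.
  move=> /ereal_sup_gt[_ [b bi <-]] /ereal_sup_gt[_ [mu [[[mu0 mu1] mean] [_ breach chain]] <-]].
  move=> /ereal_sup_gt[_ [q [q0 q1 inv] <-]]; rewrite -EFinM => rE.
  have qT := entropy_rate_support _ _ _ _ _ _ _ _ _ _ mu0 q0 rE.
  rewrite entropy_rateE // lte_fin in rE.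
  have reachb i : 0 < mu i ->
      reach (edge_weight A eta sigma pi0 sigma0 d e) (edge_disps sigma d e) b i.
    move=> mi; apply/(leadstoE (R := R)); apply: contrapT => /breach m0.
    by rewrite m0 ltxx in mi.
  have reach2 i j : 0 < mu i -> 0 < mu j ->
      reach (edge_weight A eta sigma pi0 sigma0 d e) (edge_disps sigma d e) i j \/
      reach (edge_weight A eta sigma pi0 sigma0 d e) (edge_disps sigma d e) j i.
    move=> mi mj; apply: contrapT => /not_orP[nij nji].
    have : mu i * mu j = 0 by apply: chain => /(leadstoE (R := R)).
    by apply/eqP; rewrite mulf_neq0 ?gt_eqF.
  have [N HN] := growth_lower A eta sigma pi0 sigma0 sg p0 em es D0 fin0 d e He
    alpha r b mu (fun i j => q i j) bi mu0 mu1 q0 q1 inv qT reachb reach2 mean rE eps eps0.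
  exact: limn_einf_ge HN.
have upper alpha r : ((pi0%:R^-1)%:E * S alpha < r%:E)%E ->
    exists2 eps, 0 < eps & (limn_esup (growth_rate (R := R) A eta D0 alpha eps) <= r%:E)%E.
  rewrite lte_pdivrMl // -EFinM => Sr.
  (* [S alpha] may be [-oo], whereas [growth_upper] takes a real bound. *)
  have [rho Srho rhor] : exists2 rho, (S alpha <= rho%:E)%E & rho < pi0%:R * r.
    case: (S alpha) Sr => [s| |] //; first by rewrite lte_fin => sr; exists s.
    by move=> _; exists (pi0%:R * r - 1); [rewrite leNye|lra].
  have flow_le b : initial_edges e D0 b -> forall nu,
      reachable_flow (edge_weight A eta sigma pi0 sigma0 d e) (edge_disps sigma d e)
        b (pi0%:R * alpha) nu ->
      flow_rate (edge_weight A eta sigma pi0 sigma0 d e) nu <= rho.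
    move=> bi nu flow; have [muP qP HE] := flow_kernel A eta sigma pi0 sigma0 d e b _ nu flow.
    rewrite -lee_fin -HE; apply: le_trans Srho.
    apply: le_trans (ereal_sup_ubound _); last by exists b.
    apply: le_trans (ereal_sup_ubound _); last by eexists; [exact: muP|].
    by apply: ereal_sup_ubound; eexists; [exact: qP|].
  have [eps eps0 [N HN]] := growth_upper A eta sigma pi0 sigma0 sg p0 em es D0 fin0 d e He
    alpha rho r flow_le rhor.
  by exists eps => //; exact: limn_esup_le HN.
have supE alpha : lyapunov A eta D0 alpha = ((pi0%:R^-1)%:E * S alpha)%E.
  apply: lim_at_right0 => [x y x0 xy|x x0|]; last exact: upper.
    by apply: le_limn_esup => n; exact: le_growth_rate.
  by apply: le_trans (lower _ _ x0) _; exact: limn_einf_sup.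
have infE alpha : lyapunov_inf A eta D0 alpha = ((pi0%:R^-1)%:E * S alpha)%E.
  apply: lim_at_right0 => [x y x0 xy|x x0|r /upper[x x0 xr]]; last 1 first.
  - by exists x => //; apply: le_trans xr; exact: limn_einf_sup.
  - by apply: le_limn_einf => n; exact: le_growth_rate.
  - exact: lower.
split=> // alpha; by rewrite infE supE.
Qed.
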